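(* Let $\mathbb{I}\subset\mathbb{R}$ be a bounded open interval with closure $\overline{\mathbb{I}}$ and let $x\in\mathbb{I}$. Up to isomorphism, the assignment $M\mapsto\partial_\uparrow$ is a bijection between decorous submodules $M$ of $P_x$ and functions $\partial:\overline{\mathbb{I}}\to\mathbb{R}_{\geq0}$ such that $\partial(\inf\mathbb{I})=x-\inf\mathbb{I}$, $\partial(\sup\mathbb{I})=\sup\mathbb{I}-x$, and $|\partial(y)-\partial(z)|\leq|y-z|$ for all $y\neq z\in\overline{\mathbb{I}}$. Moreover, up to isomorphism, the assignment $N\mapsto\partial_\downarrow$ is a bijection between decorous quotient modules $N$ of $P_x$ and such functions.
   Context: Let $\Bbbk$ be an algebraically closed field. $\Lambda_{\mathbb{R}}$ is the $\Bbbk$-linear category with objects the real numbers (plus a zero object) generated by morphisms $\alpha_{yx}:x\to y$ and $\alpha^*_{xy}:y\to x$ for $x<y$, with $\alpha_{xx}=\alpha^*_{xx}=1_x$, subject to: (1) $\alpha_{zy}\alpha_{yx}=\alpha_{zx}$ and $\alpha^*_{xy}\alpha^*_{yz}=\alpha^*_{xz}$ for $x\le y\le z$; (2) $\alpha^*_{x+a-b,x+a}\alpha_{x+a,x}=\alpha_{x+a-b,x-b}\alpha^*_{x-b,x}$ for $a,b>0$. $\Lambda_{\mathbb{I}}$ is the quotient category of $\Lambda_{\mathbb{R}}$ obtained by setting every object $x\notin\mathbb{I}$ isomorphic to zero. A morphism of $\Lambda_{\mathbb{I}}$ is path like if it is a nonzero composition of $\alpha$'s and $\alpha^*$'s; the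 length of $\alpha_{yx}$ and of $\alpha^*_{xy}$ is $|x-y|$ and the length of a composition is the sum of the lengths. Path like morphisms $x\to y$ are determined by their length and form a basis of $\operatorname{Hom}_{\Lambda_{\mathbb{I}}}(x,y)$. A $\Lambda_{\mathbb{I}}$-module is a $\Bbbk$-linear functor $\Lambda_{\mathbb{I}}\to\Bbbk\text{-}\mathrm{Vec}$, and $P_x=\operatorname{Hom}_{\Lambda_{\mathbb{I}}}(x,-)$. For a quotient module $N$ of $P_x$, a path like element of $N(y)$ is the image of a path like $f\in P_x(y)$ provided this image is nonzero; its length is the length of $f$. For a submodule $M\subseteq P_x$, the function $\partial_\uparrow$ on $\overline{\mathbb{I}}$ is: for $y\in\mathbb{I}$, $\partial_\uparrow(y)=\inf\{\mathrm{length}(f):f\in M(y)\text{ path like}\}$ if $M(y)\neq0$, and $\partial_\uparrow(y)=\sup\{\mathrm{length}(f):f\in\operatorname{Hom}(x,y)\text{ path like}\}$ if $M(y)=0$; $\partial_\uparrow(\inf\mathbb{I})=x-\inf\mathbb{I}$ and $\partial_\uparrow(\sup\mathbb{I})=\sup\mathbb{I}-x$. $M$ is decorous if for each $y\in\mathbb{I}$ with $M(y)\ne0$ there is a path like $f\in M(y)$ of length $\partial_\uparrow(y)$. For a quotient module $N$ of $P_x$, the function $\partial_\downarrow$ on $\overline{\mathbb{I}}$ is: for $y\in\mathbb{I}$, $\partial_\downarrow(y)=\sup\{\mathrm{length}(f):f\in N(y)\text{ path like}\}$ if $N(y)\ne0$, and $\partial_\downarrow(y)=\inf\{\mathrm{length}(f):f\in\operatorname{Hom}(x,y)\text{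 path like}\}$ if $N(y)=0$; with the same values as $\partial_\uparrow$ at $\inf\mathbb{I},\sup\mathbb{I}$. $N$ is decorous if for each $y\in\mathbb{I}$ there is no path like $f\in N(y)$ of length $\partial_\downarrow(y)$. *)

(* Defs.v *)
From HB Require Import structures.
From mathcomp Require Import all_boot all_order all_algebra.
From mathcomp Require Import generic_quotient.
From mathcomp Require Import mathcomp_extra boolp classical_sets set_interval reals.

Set Implicit Arguments.
Unset Strict Implicit.
Unset Printing Implicit Defensive.

Import Order.TTheory GRing.Theory Num.Theory.
Local Open Scope classical_set_scope.
Local Open Scope quotient_scope.
Local Open Scope ring_scope.

Record lincat (K : fieldType) := Lincat {
  ob :> Type;
  hom : ob -> ob -> lmodType K;
  idm : forall x, hom x x;
  compm : forall x y z, hom y z -> hom x y -> hom x z;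
  comp1m : forall x y (f : hom x y), compm (idm y) f = f;
  compm1 : forall x y (f : hom x y), compm f (idm x) = f;
  compA : forall w x y z (h : hom y z) (g : hom x y) (f : hom w x),
    compm h (compm g f) = compm (compm h g) f;
  comp_linl : forall x y z c (g g' : hom y z) (f : hom x y),
    compm (c *: g + g') f = c *: compm g f + compm g' f;
  comp_linr : forall x y z c (g : hom y z) (f f' : hom x y),
    compm g (c *: f + f') = c *: compm g f + compm g f'
}.
Arguments idm {K C} x : rename.
Arguments compm {K C x y z} g f : rename.

Record module (K : fieldType) (C : lincat K) := Module {
  mob :> C -> lmodType K;
  mmap : forall x y, hom x y -> {linear mob x -> mob y};
  mmap1 : forall x (v : mob x), mmap (idm x) v = v;
  mmapM : forall x y z (g : hom y z) (f : hom x y) (v : mob x),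
    mmap (compm g f) v = mmap g (mmap f v);
  mmap_lin : forall x y c (f g : hom x y) (v : mob x),
    mmap (c *: f + g) v = c *: mmap f v + mmap g v
}.
Arguments mmap {K C} F {x y} f : rename.

Record modmor (K : fieldType) (C : lincat K) (F G : module C) := Modmor {
  mmor :> forall x, {linear F x -> G x};
  mmor_nat : forall x y (f : hom x y) (v : F x),
    mmor y (mmap F f v) = mmap G f (mmor x v)
}.

Definition isomodule (K : fieldType) (C : lincat K) (F G : module C) : Prop :=
  exists phi : modmor F G, forall x, bijective (phi x).

Record submodule (K : fieldType) (C : lincat K) (F : module C) := Submodule {
  sub_set :> forall x, set (F x);
  sub0 : forall x, @sub_set x 0;
  sub_lin : forall x c (u v : F x),
    @sub_set x u -> @sub_set x v -> @sub_set x (c *: u + v);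
  sub_map : forall x y (f : hom x y) (u : F x),
    @sub_set x u -> @sub_set y (mmap F f u)
}.

Arguments sub_set {K C F} M x _ : rename.

Record quotient_module (K : fieldType) (C : lincat K) (F : module C) :=
  QuotientModule {
    qmod :> module C;
    qproj : modmor F qmod;
    qproj_surj : forall x (v : qmod x), exists u : F x, qproj x u = v
  }.
Arguments qproj {K C F} N : rename.

Section SubmoduleAsModule.
Variables (K : fieldType) (C : lincat K) (F : module C) (M : submodule F).

Definition sub_pred (x : C) : {pred F x} := [pred u | `[< M x u >]].
Arguments sub_pred x : clear implicits.

Lemma sub_predE x u : (u \in sub_pred x) = `[< M x u >].
Proof. by []. Qed.

Lemma sub_pred_closed x : submod_closed (sub_pred x).
Proof.
split=> [|c u v]; rewrite !sub_predE; first exact/asboolP/sub0.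
by move=> /asboolP Mu /asboolP Mv; exact/asboolP/sub_lin.
Qed.

HB.instance Definition _ x :=
  GRing.isSubmodClosed.Build K (F x) (sub_pred x) (sub_pred_closed x).

Definition sub_type (x : C) := {u : F x | u \in sub_pred x}.
HB.instance Definition _ x := SubChoice.on (sub_type x).
HB.instance Definition _ x := [SubChoice_isSubLmodule of sub_type x by <:].

Lemma sub_mapP x y (f : hom x y) (u : sub_type x) :
  mmap F f (val u) \in sub_pred y.
Proof.
by case: u => u /= /asboolP Mu; rewrite sub_predE; apply/asboolP/sub_map.
Qed.

Definition sub_mmap x y (f : hom x y) (u : sub_type x) : sub_type y :=
  exist _ (mmap F f (val u)) (sub_mapP f u).

Lemma sub_mmap_linear x y (f : hom x y) : linear (sub_mmap f).
Proof. by move=> c u v; apply/val_inj; rewrite /= !linearP. Qed.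

HB.instance Definition _ x y (f : hom x y) :=
  GRing.isLinear.Build K (sub_type x) (sub_type y) *:%R (sub_mmap f)
    (sub_mmap_linear f).

Definition sub_module : module C.
Proof.
refine (@Module K C (fun x => sub_type x : lmodType K)
  (fun x y f => sub_mmap f : {linear _ -> _}) _ _ _).
- by move=> x v; apply/val_inj; rewrite /= mmap1.
- by move=> x y z g f v; apply/val_inj; rewrite /= mmapM.
- by move=> x y c f g v; apply/val_inj; rewrite /= mmap_lin.
Defined.

End SubmoduleAsModule.

Section Representable.
Variables (K : fieldType) (C : lincat K) (x : C).

Definition postcomp y z (g : hom y z) (f : hom x y) : hom x z := compm g f.

Lemma postcomp_linear y z (g : hom y z) : linear (postcomp g).
Proof. by move=> c f f'; exact: comp_linr. Qed.

HB.instance Definition _ y z (g : hom y z) :=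
  GRing.isLinear.Build K (hom x y) (hom x z) *:%R (postcomp g)
    (postcomp_linear g).

Definition representable : module C.
Proof.
refine (@Module K C (fun y => hom x y)
  (fun y z g => postcomp g : {linear _ -> _}) _ _ _).
- by move=> y f; exact: comp1m.
- by move=> y z w g f h; rewrite /= /postcomp compA.
- by move=> y z c f g h; exact: comp_linl.
Defined.

End Representable.

Variant lambda_ob (R : Type) := zero_pt | pt of R.
Arguments zero_pt {R}.

(* The K-linear expressions in the generators; [t_up] stands for alpha_{yx} and
   [t_down] for alpha^*_{xy}, including the case x = y, where the congruence
   [teq] identifies both with the identity. *)
Inductive term (K : fieldType) (R : realType) : lambda_ob R -> lambda_ob R -> Type :=
| t_id x : term K x x
| t_comp x y z : term K y z -> term K x y -> term K x z
| t_zero x y : term K x y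
| t_add x y : term K x y -> term K x y -> term K x y
| t_opp x y : term K x y -> term K x y
| t_scale x y : K -> term K x y -> term K x y
| t_up (x y : R) : x <= y -> term K (pt x) (pt y)
| t_down (x y : R) : x <= y -> term K (pt y) (pt x).
Arguments t_id {K R} x.
Arguments t_zero {K R} x y.
Arguments t_up {K R x y} _.
Arguments t_down {K R x y} _.

(* The congruence presenting Lambda_I: the axioms of K-linear categories, the
   defining relations of Lambda_R (which is the case I = setT), and 1_x = 0
   for x outside I, which kills exactly the ideal generated by these objects. *)
Inductive teq (K : fieldType) (R : realType) (I : set R) :
  forall x y : lambda_ob R, term K x y -> term K x y -> Prop :=
| teq_refl x y (f : term K x y) : teq I f f
| teq_sym x y (f g : term K x y) : teq I f g -> teq I g f
| teq_trans x y (f g h : term K x y) : teq I f g -> teq I g h -> teq I f h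
| teq_comp x y z (g g' : term K y z) (f f' : term K x y) :
    teq I g g' -> teq I f f' -> teq I (t_comp g f) (t_comp g' f')
| teq_add x y (f f' g g' : term K x y) :
    teq I f f' -> teq I g g' -> teq I (t_add f g) (t_add f' g')
| teq_opp x y (f f' : term K x y) : teq I f f' -> teq I (t_opp f) (t_opp f')
| teq_scale x y c (f f' : term K x y) :
    teq I f f' -> teq I (t_scale c f) (t_scale c f')
| teq_addA x y (f g h : term K x y) :
    teq I (t_add f (t_add g h)) (t_add (t_add f g) h)
| teq_addC x y (f g : term K x y) : teq I (t_add f g) (t_add g f)
| teq_add0 x y (f : term K x y) : teq I (t_add (t_zero x y) f) f
| teq_addN x y (f : term K x y) : teq I (t_add (t_opp f) f) (t_zero x y)
| teq_scaleA x y c d (f : term K x y) :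
    teq I (t_scale c (t_scale d f)) (t_scale (c * d) f)
| teq_scale1 x y (f : term K x y) : teq I (t_scale 1 f) f
| teq_scaleDr x y c (f g : term K x y) :
    teq I (t_scale c (t_add f g)) (t_add (t_scale c f) (t_scale c g))
| teq_scaleDl x y c d (f : term K x y) :
    teq I (t_scale (c + d) f) (t_add (t_scale c f) (t_scale d f))
| teq_comp1m x y (f : term K x y) : teq I (t_comp (t_id y) f) f
| teq_compm1 x y (f : term K x y) : teq I (t_comp f (t_id x)) f
| teq_compA w x y z (h : term K y z) (g : term K x y) (f : term K w x) :
    teq I (t_comp h (t_comp g f)) (t_comp (t_comp h g) f)
| teq_compDl x y z (g g' : term K y z) (f : term K x y) :
    teq I (t_comp (t_add g g') f) (t_add (t_comp g f) (t_comp g' f))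
| teq_compZl x y z c (g : term K y z) (f : term K x y) :
    teq I (t_comp (t_scale c g) f) (t_scale c (t_comp g f))
| teq_compDr x y z (g : term K y z) (f f' : term K x y) :
    teq I (t_comp g (t_add f f')) (t_add (t_comp g f) (t_comp g f'))
| teq_compZr x y z c (g : term K y z) (f : term K x y) :
    teq I (t_comp g (t_scale c f)) (t_scale c (t_comp g f))
| teq_up_id (x : R) (h : x <= x) : teq I (t_up h) (t_id (pt x))
| teq_down_id (x : R) (h : x <= x) : teq I (t_down h) (t_id (pt x))
| teq_up_up (x y z : R) (hxy : x <= y) (hyz : y <= z) (hxz : x <= z) :
    teq I (t_comp (t_up hyz) (t_up hxy)) (t_up hxz)
| teq_down_down (x y z : R) (hxy : x <= y) (hyz : y <= z) (hxz : x <= z) :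
    teq I (t_comp (t_down hxy) (t_down hyz)) (t_down hxz)
| teq_up_down (x a b : R) (a0 : 0 < a) (b0 : 0 < b)
    (h1 : x <= x + a) (h2 : x + a - b <= x + a)
    (h3 : x - b <= x) (h4 : x - b <= x + a - b) :
    teq I (t_comp (t_down h2) (t_up h1)) (t_comp (t_up h4) (t_down h3))
| teq_zero_pt : teq I (t_id zero_pt) (t_zero zero_pt zero_pt)
| teq_outside (x : R) : ~ I x -> teq I (t_id (pt x)) (t_zero (pt x) (pt x)).

Section Lambda.
Variables (K : fieldType) (R : realType) (I : set R).
Implicit Types x y z : lambda_ob R.

HB.instance Definition _ x y := gen_eqMixin (term K x y).
HB.instance Definition _ x y := gen_choiceMixin (term K x y).

Definition teqb x y : rel (term K x y) := fun f g => `[< teq I f g >].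

Lemma teqb_equiv x y : equiv_class_of (@teqb x y).
Proof.
split=> [f|f g|g f h]; first exact/asboolP/teq_refl.
- by apply/asboolP/asboolP; exact: teq_sym.
- by move=> /asboolP fg /asboolP gh; apply/asboolP; exact: teq_trans fg gh.
Qed.

Canonical teq_equiv x y := EquivRelPack (@teqb_equiv x y).

Definition lhom x y := {eq_quot (teq_equiv x y)}.
HB.instance Definition _ x y := Choice.on (lhom x y).

Definition cls x y (f : term K x y) : lhom x y := \pi_(lhom x y) f.

Lemma clsP x y (f g : term K x y) : cls f = cls g <-> teq I f g.
Proof.
split=> [/eqmodP /asboolP//|fg]; apply/eqmodP; exact/asboolP.
Qed.

Lemma cls_repr x y (u : lhom x y) : cls (repr u) = u.
Proof. exact: reprK. Qed.

Lemma repr_cls x y (f : term K x y) : teq I (repr (cls f)) f.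
Proof. by apply/clsP; rewrite cls_repr. Qed.

Definition lzero x y : lhom x y := cls (t_zero x y).
Definition ladd x y (u v : lhom x y) : lhom x y := cls (t_add (repr u) (repr v)).
Definition lopp x y (u : lhom x y) : lhom x y := cls (t_opp (repr u)).
Definition lscale x y c (u : lhom x y) : lhom x y := cls (t_scale c (repr u)).
Definition lcomp x y z (v : lhom y z) (u : lhom x y) : lhom x z :=
  cls (t_comp (repr v) (repr u)).

Lemma laddE x y (f g : term K x y) : ladd (cls f) (cls g) = cls (t_add f g).
Proof. by apply/clsP/teq_add; exact: repr_cls. Qed.

Lemma loppE x y (f : term K x y) : lopp (cls f) = cls (t_opp f).
Proof. by apply/clsP/teq_opp; exact: repr_cls. Qed.

Lemma lscaleE x y c (f : term K x y) : lscale c (cls f) = cls (t_scale c f).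
Proof. by apply/clsP/teq_scale; exact: repr_cls. Qed.

Lemma lcompE x y z (g : term K y z) (f : term K x y) :
  lcomp (cls g) (cls f) = cls (t_comp g f).
Proof. by apply/clsP/teq_comp; exact: repr_cls. Qed.

Lemma laddA x y : associative (@ladd x y).
Proof.
move=> u v w; rewrite -(cls_repr u) -(cls_repr v) -(cls_repr w) !laddE.
exact/clsP/teq_addA.
Qed.

Lemma laddC x y : commutative (@ladd x y).
Proof.
by move=> u v; rewrite -(cls_repr u) -(cls_repr v) !laddE; exact/clsP/teq_addC.
Qed.

Lemma ladd0 x y : left_id (@lzero x y) (@ladd x y).
Proof. by move=> u; rewrite -(cls_repr u) laddE; exact/clsP/teq_add0. Qed.

Lemma laddN x y : left_inverse (@lzero x y) (@lopp x y) (@ladd x y).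
Proof.
by move=> u; rewrite -(cls_repr u) loppE laddE; exact/clsP/teq_addN.
Qed.

HB.instance Definition _ x y :=
  GRing.isZmodule.Build (lhom x y)
    (@laddA x y) (@laddC x y) (@ladd0 x y) (@laddN x y).

Lemma lscaleA x y c d (u : lhom x y) : lscale c (lscale d u) = lscale (c * d) u.
Proof. by rewrite -(cls_repr u) !lscaleE; exact/clsP/teq_scaleA. Qed.

Lemma lscale1 x y : left_id 1 (@lscale x y).
Proof. by move=> u; rewrite -(cls_repr u) lscaleE; exact/clsP/teq_scale1. Qed.

Lemma lscaleDr x y : right_distributive (@lscale x y) +%R.
Proof.
move=> c u v; change (lscale c (cls (t_add (repr u) (repr v))) =
  ladd (cls (t_scale c (repr u))) (cls (t_scale c (repr v)))).
rewrite lscaleE laddE.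
exact/clsP/teq_scaleDr.
Qed.

Lemma lscaleDl x y (u : lhom x y) : {morph (@lscale x y)^~ u : c d / c + d}.
Proof.
move=> c d; rewrite -(cls_repr u) !lscaleE [RHS]laddE.
exact/clsP/teq_scaleDl.
Qed.

HB.instance Definition _ x y :=
  GRing.Zmodule_isLmodule.Build K (lhom x y)
    (@lscaleA x y) (@lscale1 x y) (@lscaleDr x y) (@lscaleDl x y).

Lemma cls_lin x y c (f g : term K x y) :
  c *: cls f + cls g = cls (t_add (t_scale c f) g).
Proof. by rewrite [c *: _]lscaleE; exact: laddE. Qed.

Definition Lambda : lincat K.
Proof.
refine (@Lincat K (lambda_ob R) (fun x y => lhom x y : lmodType K)
  (fun x => cls (t_id x)) (fun x y z => @lcomp x y z) _ _ _ _ _).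
- by move=> x y f; rewrite -(cls_repr f) lcompE; exact/clsP/teq_comp1m.
- by move=> x y f; rewrite -(cls_repr f) lcompE; exact/clsP/teq_compm1.
- move=> w x y z h g f.
  rewrite -(cls_repr f) -(cls_repr g) -(cls_repr h) !lcompE.
  exact/clsP/teq_compA.
- move=> x y z c g g' f.
  rewrite -(cls_repr f) -(cls_repr g) -(cls_repr g') cls_lin !lcompE cls_lin.
  apply/clsP; apply: teq_trans (teq_compDl _ _ _ _) _.
  by apply: teq_add (teq_compZl _ _ _ _) (teq_refl _ _).
- move=> x y z c g f f'.
  rewrite -(cls_repr f) -(cls_repr g) -(cls_repr f') cls_lin !lcompE cls_lin.
  apply/clsP; apply: teq_trans (teq_compDr _ _ _ _) _.
  by apply: teq_add (teq_compZr _ _ _ _) (teq_refl _ _).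
Defined.

Definition alpha (x y : R) (h : x <= y) : @hom K Lambda (pt x) (pt y) :=
  cls (t_up h).

Definition alpha_star (x y : R) (h : x <= y) : @hom K Lambda (pt y) (pt x) :=
  cls (t_down h).

(* [composition_of_length f l]: f is a composition of alphas and alpha^*s
   whose lengths add up to l. *)
Inductive composition_of_length (x : Lambda) :
  forall y : Lambda, @hom K Lambda x y -> R -> Prop :=
| comp_nil : composition_of_length (idm x) 0
| comp_up (y z : R) (h : y <= z) (f : @hom K Lambda x (pt y)) (l : R) :
    composition_of_length f l ->
    composition_of_length (compm (alpha h) f) (`|y - z| + l)
| comp_down (y z : R) (h : z <= y) (f : @hom K Lambda x (pt y)) (l : R) :
    composition_of_length f l ->
    composition_of_length (compm (alpha_star h) f) (`|y - z| + l).

Definition path_like (x y : Lambda) (f : @hom K Lambda x y) (l : R) : Prop :=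
  composition_of_length f l /\ f != 0.

Definition hom_lengths (x y : R) : set R :=
  [set l | exists f : @hom K Lambda (pt x) (pt y), path_like f l].

End Lambda.

Definition open_itv (R : realType) (a b : R) : set R := `]a, b[.

(* The closure of ]a, b[ when a < b. *)
Definition closure_itv (R : realType) (a b : R) : Type :=
  {y : R | y \in `[a, b]}.

Section Boundary.
Variables (K : fieldType) (R : realType) (a b x : R).

Definition Lambda_itv : lincat K := Lambda K (open_itv a b).

Definition P_ : module Lambda_itv := @representable K Lambda_itv (pt x).

Section Sub.
Variable M : submodule P_.

Definition sub_nonzero (y : R) : Prop := exists f, M (pt y) f /\ f != 0.

Definition sub_lengths (y : R) : set R :=
  [set l | exists f, M (pt y) f /\ path_like f l].

Definition del_up (y : closure_itv a b) : R :=
  if val y == a then x - a else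
  if val y == b then b - x else
  if `[< sub_nonzero (val y) >] then inf (sub_lengths (val y))
  else sup (hom_lengths K (open_itv a b) x (val y)).

Definition decorous_sub : Prop :=
  forall y : closure_itv a b, open_itv a b (val y) ->
    sub_nonzero (val y) -> sub_lengths (val y) (del_up y).

End Sub.

Section Quot.
Variable N : quotient_module P_.

Definition quot_nonzero (y : R) : Prop := exists v : N (pt y), v != 0.

Definition quot_path_like (y : R) (v : N (pt y)) (l : R) : Prop :=
  v != 0 /\ exists f, path_like f l /\ qproj N (pt y) f = v.

Definition quot_lengths (y : R) : set R :=
  [set l | exists v : N (pt y), quot_path_like v l].

Definition del_down (y : closure_itv a b) : R :=
  if val y == a then x - a else
  if val y == b then b - x else
  if `[< quot_nonzero (val y) >] then sup (quot_lengths (val y))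
  else inf (hom_lengths K (open_itv a b) x (val y)).

Definition decorous_quot : Prop :=
  forall y : closure_itv a b, open_itv a b (val y) ->
    ~ quot_lengths (val y) (del_down y).

End Quot.

Definition admissible (d : closure_itv a b -> R) : Prop :=
  [/\ forall y, 0 <= d y,
      forall y, val y = a -> d y = x - a,
      forall y, val y = b -> d y = b - x &
      forall y z, y <> z -> `|d y - d z| <= `|val y - val z|].

End Boundary.

(* [f] induces a bijection from the [eqv]-classes of elements of [A] to [B];
   predicates rather than [set]s, whose universe is too small for modules. *)
Definition bij_up_to (T U : Type) (eqv : T -> T -> Prop)
    (A : T -> Prop) (B : U -> Prop) (f : T -> U) : Prop :=
  [/\ forall t, A t -> B (f t),
      forall t t', A t -> A t' -> (eqv t t' <-> f t = f t') &
      forall u, B u -> exists t, A t /\ f t = u].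

(* Main.v *)
Require Import Defs.
From HB Require Import structures.
From mathcomp Require Import all_boot all_order all_algebra.
From mathcomp Require Import mathcomp_extra boolp classical_sets set_interval reals.
From mathcomp Require Import ring lra.
Import Defs.

(** A path from [x] to [y] that descends by [d] and ascends by [u] has length
    [l = d + u] with [u - d = y - x], so its length determines its lowest point
    [(x + y - l) / 2], and also the highest point [(x + y + l) / 2] of the path
    that ascends first.  The commutation relation identifies all paths of the
    same length, so a path of length [l] vanishes as soon as one of these two
    points leaves the interval.  Hence nonzero paths from [x] to [y] have
    lengths in the half-open range

      [`|x - y| <= l < min (x + y - 2 a) (2 b - x - y)],

    whose bounds are called [minlen y] and [suplen y] below.  That they do not
    vanish, and are independent, is seen by letting the category act on
    functions of the length: a generator of length [s] shifts a function by [s]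
    and truncates it to the range of its target ([eval_term_sound]).  Applied to
    the delta function at length zero this gives coefficients [lcoef u l], and
    every morphism out of [x] is the sum of the paths weighted by its
    coefficients ([expansion]).

    A morphism [u] from [x] to [y] with lowest coefficient at [l0] is the path
    of length [l0] followed by an endomorphism of [y] that is a nonzero scalar
    plus a part that raises the length by a fixed positive amount.  Lengths
    being bounded, that part is nilpotent and the endomorphism is invertible;
    therefore a submodule that contains [u] contains this path
    ([leading_path]), and every submodule is spanned by the paths in it
    ([mem_submodule]).  Since the lengths of these paths form an up-closed set
    at each [y], a submodule is described by a threshold [d y] together with the
    information whether the threshold itself is attained.  Decorous means that
    it is attained, for a submodule; for a quotient it means that it is attained
    by the kernel.  Both cases are thus governed by one notion, [cut M d]: at
    [y], the submodule [M] contains exactly the paths of length at least [d y].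

    Stability of [M] under the generators amounts to [d] being 1-Lipschitz, and
    as [minlen] and [suplen] agree at the end points of the interval, the
    boundary values come for free ([cut_admissible]); conversely a Lipschitz
    function with these boundary values lies between [minlen] and [suplen] and
    cuts out a submodule ([admissible_cut]).

    Finally an isomorphism class determines the threshold.  Isomorphic modules
    have the same annihilators, and the loop of length [t] at [y] kills a
    decorous submodule at [y] if and only if [d y + t >= suplen y], and kills a
    decorous quotient if and only if [minlen y + t >= d y] ([sub_iso_le],
    [quot_iso_le]). *)

Set Implicit Arguments.
Unset Strict Implicit.
Unset Printing Implicit Defensive.

Import Order.TTheory GRing.Theory Num.Theory.
Local Open Scope classical_set_scope.
Local Open Scope ring_scope.

(** * The action of morphisms on functions of the length *)

Section Model.
Variables (K : fieldType) (R : realType) (a b x : R).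
Local Notation I := (open_itv a b).
Implicit Types (phi : R -> K) (l s : R).

(** Lengths of the nonzero paths from [x] to [y]: both the lowest point
    [(x + y - l) / 2] and the highest point [(x + y + l) / 2] of such a path lie
    strictly between [a] and [b]. The range is empty when [y] itself does not,
    which is what makes objects outside the interval vanish. *)
Definition in_range (y : lambda_ob R) (l : R) : bool :=
  if y is pt y then
    [&& x - y <= l, y - x <= l, l < x + y - 2 * a & l < 2 * b - x - y]
  else false.

Definition supported (y : lambda_ob R) phi :=
  forall l, ~~ in_range y l -> phi l = 0.

Definition shift (y : R) (s : R) phi : R -> K :=
  fun l => if in_range (pt y) l then phi (l - s) else 0.

(** The value at [l] of a function is to be thought of as the coefficient of the
    path of length [l] out of the fixed point [x]; composing with a generator
    then shifts by its length and forgets the paths that have become zero. *)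
Fixpoint eval_term (y z : lambda_ob R) (t : term K y z) : (R -> K) -> R -> K :=
  match t with
  | t_id _ => id
  | t_comp _ _ _ g f => fun phi => eval_term g (eval_term f phi)
  | t_zero _ _ => fun _ _ => 0
  | t_add _ _ f g => fun phi l => eval_term f phi l + eval_term g phi l
  | t_opp _ _ f => fun phi l => - eval_term f phi l
  | t_scale _ _ c f => fun phi l => c * eval_term f phi l
  | t_up y z _ => shift z (z - y)
  | t_down y z _ => shift y (z - y)
  end.

Lemma eval_term_supported y z (t : term K y z) phi :
  supported y phi -> supported z (eval_term t phi).
Proof.
elim: t phi => //=.
- by move=> ? ? ? g IHg f IHf phi sphi; exact/IHg/IHf.
- by move=> ? ? f IHf g IHg phi sphi l zl; rewrite IHf// IHg// addr0.
- by move=> ? ? f IHf phi sphi l zl; rewrite IHf// oppr0.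
- by move=> ? ? c f IHf phi sphi l zl; rewrite IHf// mulr0.
- by move=> u v uv phi sphi l /negPf zl; rewrite /shift zl.
- by move=> u v uv phi sphi l /negPf zl; rewrite /shift zl.
Qed.

Lemma eval_term_lin y z (t : term K y z) c phi psi :
  eval_term t (fun l => c * phi l + psi l) =
  (fun l => c * eval_term t phi l + eval_term t psi l).
Proof.
elim: t c phi psi => //=.
- by move=> ? ? ? g IHg f IHf c phi psi; rewrite IHf IHg.
- by move=> ? ? c phi psi; apply/funext => l; rewrite mulr0 addr0.
- by move=> ? ? f IHf g IHg c phi psi; apply/funext => l;
    rewrite IHf IHg mulrDr addrACA.
- by move=> ? ? f IHf c phi psi; apply/funext => l; rewrite IHf opprD mulrN.
- by move=> ? ? c f IHf d phi psi; apply/funext => l;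
    rewrite IHf mulrDr mulrCA.
- by move=> u v uv c phi psi; apply/funext => l; rewrite /shift;
    case: ifP; rewrite // mulr0 addr0.
- by move=> u v uv c phi psi; apply/funext => l; rewrite /shift;
    case: ifP; rewrite // mulr0 addr0.
Qed.

Lemma not_in_range y : ~ I y -> forall l, in_range (pt y) l = false.
Proof.
move=> nIy l; apply/negP => /and4P[h1 h2 h3 h4]; apply: nIy.
by rewrite /open_itv /= in_itv /=; apply/andP; split; lra.
Qed.

Lemma in_range_itv y l : in_range (pt y) l -> I y.
Proof. by move=> yl; apply: contrapT => /not_in_range/(_ l); rewrite yl. Qed.

(** Intermediate truncations can be omitted, because the upper end of the range
    moves by at most the length of a generator: a shifted argument that is in
    range for the target is, up to zero values, in range for any point passed on
    the way. So every relation reduces to an equality between total shifts. *)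
Lemma eval_term_sound y z (f g : term K y z) phi :
  teq I f g -> supported y phi -> eval_term f phi = eval_term g phi.
Proof.
move=> fg; elim: fg phi => {y z f g} /=.
- by [].
- by move=> ? ? f g _ IH phi /IH.
- by move=> ? ? f g h _ IH1 _ IH2 phi sphi; rewrite IH1 ?IH2.
- move=> ? ? ? g g' f f' _ IHg _ IHf phi sphi; rewrite (IHf _ sphi).
  by apply: IHg; exact: eval_term_supported.
- by move=> ? ? f f' g g' _ IHf _ IHg phi sphi; rewrite IHf// IHg.
- by move=> ? ? f f' _ IHf phi sphi; rewrite IHf.
- by move=> ? ? c f f' _ IHf phi sphi; rewrite IHf.
- by move=> *; apply/funext => l; rewrite addrA.
- by move=> *; apply/funext => l; rewrite addrC.
- by move=> *; apply/funext => l; rewrite add0r.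
- by move=> *; apply/funext => l; rewrite addNr.
- by move=> *; apply/funext => l; rewrite mulrA.
- by move=> *; apply/funext => l; rewrite mul1r.
- by move=> *; apply/funext => l; rewrite mulrDr.
- by move=> *; apply/funext => l; rewrite mulrDl.
- by [].
- by [].
- by [].
- by [].
- by [].
- move=> ? ? ? g f f' phi _.
  have := eval_term_lin g 1 (eval_term f phi) (eval_term f' phi).
  have -> : (fun l => 1 * eval_term f phi l + eval_term f' phi l) =
            (fun l => eval_term f phi l + eval_term f' phi l).
    by apply/funext => l; rewrite mul1r.
  by move=> ->; apply/funext => l; rewrite mul1r.
- move=> ? ? ? c g f phi _.
  have := eval_term_lin g c (eval_term f phi) (fun=> 0).
  have -> : (fun l => c * eval_term f phi l + 0) =
            (fun l => c * eval_term f phi l).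
    by apply/funext => l; rewrite addr0.
  move=> ->; apply/funext => l.
  have := eval_term_lin g (-1) (fun=> 0) (fun=> 0).
  have -> : (fun=> -1 * 0 + 0) = (fun=> 0) :> (R -> K).
    by apply/funext => k; rewrite mulr0 addr0.
  move=> /(congr1 (fun F => F l)) /=; rewrite mulN1r addNr => ->.
  by rewrite addr0.
- move=> y _ phi sphi; apply/funext => l; rewrite /shift subrr subr0.
  by case: ifPn => // /sphi.
- move=> y _ phi sphi; apply/funext => l; rewrite /shift subrr subr0.
  by case: ifPn => // /sphi.
- move=> u v w uv vw uw phi sphi; apply/funext=> l.
  rewrite /shift; case: ifP => // /and4P[h1 h2 h3 h4].
  case: ifPn; first by move=> _; congr phi; ring.
  move=> n; symmetry; apply: sphi; apply: contra n => /and4P[k1 k2 k3 k4].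
  by apply/and4P; split; lra.
- move=> u v w uv vw uw phi sphi; apply/funext=> l.
  rewrite /shift; case: ifP => // /and4P[h1 h2 h3 h4].
  case: ifPn; first by move=> _; congr phi; ring.
  move=> n; symmetry; apply: sphi; apply: contra n => /and4P[k1 k2 k3 k4].
  by apply/and4P; split; lra.
- move=> u c d c0 d0 h1 h2 h3 h4 phi sphi; apply/funext=> l.
  rewrite /shift; case: ifP => // /and4P[k1 k2 k3 k4].
  have e : l - (u + c - (u + c - d)) - (u + c - u) =
           l - (u + c - d - (u - d)) - (u - (u - d)) by ring.
  case: ifPn => n; case: ifPn => m; rewrite ?e//.
  + apply: sphi; apply: contra m => /and4P[m1 m2 m3 m4].
    by apply/and4P; split; lra.
  + symmetry; apply: sphi; apply: contra n => /and4P[m1 m2 m3 m4].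
    by apply/and4P; split; lra.
- by move=> phi sphi; apply/funext => l; rewrite sphi.
- move=> y nIy phi sphi; apply/funext => l; rewrite sphi//.
  by rewrite not_in_range.
Qed.

End Model.
Arguments in_range : simpl never.

(** * Paths are determined by their length and span *)

Section Compositions.
Variables (K : fieldType) (R : realType) (I : set R).
Local Notation C := (Lambda K I).

Lemma composition_length_ge y (z : C) (f : @hom K C (pt y) z) l :
  composition_of_length f l ->
  if z is pt z then y - z <= l /\ z - y <= l else True.
Proof.
elim=> {z f l} [|u v uv f l _|u v uv f l _]; first by lra.
- by case=> h1 h2; rewrite ler0_norm ?subr_le0//; split; lra.
- by case=> h1 h2; rewrite ger0_norm ?subr_ge0//; split; lra.
Qed.

Lemma composition_comp (x y z : C) (f : hom x y) (g : hom y z) l m :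
  composition_of_length f l -> composition_of_length g m ->
  composition_of_length (compm g f) (m + l).
Proof.
move=> cf; elim=> {z g m} [|u v uv g m _ IH|u v uv g m _ IH].
- by rewrite comp1m add0r.
- by rewrite -compA -addrA; exact: comp_up.
- by rewrite -compA -addrA; exact: comp_down.
Qed.

Lemma composition_alpha (y z : R) (yz : y <= z) :
  composition_of_length (alpha K I yz) (z - y).
Proof.
have := comp_up yz (comp_nil (pt y : C)).
by rewrite addr0 compm1 ler0_norm ?subr_le0// opprB.
Qed.

Lemma composition_alpha_star (y z : R) (yz : y <= z) :
  composition_of_length (alpha_star K I yz) (z - y).
Proof.
have := comp_down yz (comp_nil (pt z : C)).
by rewrite addr0 compm1 ger0_norm ?subr_ge0.
Qed.

Lemma alpha1 (y : R) (h : y <= y) : alpha K I h = idm (pt y : C).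
Proof. exact/clsP/teq_up_id. Qed.

Lemma alpha_star1 (y : R) (h : y <= y) : alpha_star K I h = idm (pt y : C).
Proof. exact/clsP/teq_down_id. Qed.

Lemma alpha_comp (x y z : R) (xy : x <= y) (yz : y <= z) (xz : x <= z) :
  compm (alpha K I yz) (alpha K I xy) = alpha K I xz.
Proof. by rewrite /= lcompE; exact/clsP/teq_up_up. Qed.

Lemma alpha_star_comp (x y z : R) (xy : x <= y) (yz : y <= z) (xz : x <= z) :
  compm (alpha_star K I xy) (alpha_star K I yz) = alpha_star K I xz.
Proof. by rewrite /= lcompE; exact/clsP/teq_down_down. Qed.

(** The commutation relation without the restriction to nonzero shifts and with
    the four corners of the parallelogram as free variables. *)
Lemma alpha_commute (m w y z : R)
    (my : m <= y) (zy : z <= y) (wm : w <= m) (wz : w <= z) :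
  m + z = w + y ->
  compm (alpha_star K I zy) (alpha K I my) =
  compm (alpha K I wz) (alpha_star K I wm).
Proof.
move=> e.
case: (eqVneq m y) => [my'|my'].
  subst m; have ? : z = w by lra.
  by subst z; rewrite !alpha1 compm1 comp1m; congr alpha_star.
case: (eqVneq z y) => [zy'|zy'].
  subst z; have ? : m = w by lra.
  by subst m; rewrite !alpha_star1 compm1 comp1m; congr alpha.
have [c c0] : exists2 c, 0 < c & y = m + c.
  by exists (y - m); [rewrite subr_gt0 lt_neqAle my' my|ring].
have [d d0] : exists2 d, 0 < d & w = m - d.
  by exists (y - z); [rewrite subr_gt0 lt_neqAle zy' zy|lra].
move=> ew ey; have ez : z = m + c - d by lra.
subst w y z; rewrite /= !lcompE; exact/clsP/teq_up_down.
Qed.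

(** Descents are moved in front of ascents; the lowest point [m] is tied to the
    length by [2 m = y + z - l], so no choice is left. *)
Lemma composition_normal_form y (z : C) (f : @hom K C (pt y) z) l :
  composition_of_length f l ->
  (if z is pt z then fun f : @hom K C (pt y) (pt z) =>
    forall m (my : m <= y) (mz : m <= z), 2 * m = y + z - l ->
       f = compm (alpha K I mz) (alpha_star K I my)
  else fun=> True) f.
Proof.
elim=> {z f l} [|u v uv f l cf IH|u v vu f l cf IH].
- move=> m my mz e; have ? : m = y by lra.
  by subst m; rewrite alpha1 alpha_star1 comp1m.
- move=> m my mv; rewrite ler0_norm ?subr_le0// => e.
  have [h1 h2] := composition_length_ge cf.
  have mu : m <= u by lra.
  rewrite (IH m my mu); last by lra.
  by rewrite compA alpha_comp.
- move=> m my mv; rewrite ger0_norm ?subr_ge0// => e.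
  have [h1 h2] := composition_length_ge cf.
  (* Descending from [u] to [v] lowers the lowest point of the path by [u - v],
     so [n] is the lowest point before the last generator. *)
  pose n := m + (u - v).
  have ny : n <= y by rewrite /n; lra.
  have nu : n <= u by rewrite /n; lra.
  have mn : m <= n by rewrite /n; lra.
  rewrite (IH n ny nu); last by rewrite /n; lra.
  rewrite compA (alpha_commute nu vu mn mv); last by rewrite /n; ring.
  by rewrite -compA alpha_star_comp.
Qed.

Lemma composition_exists (y z l : R) : y - z <= l -> z - y <= l ->
  exists f : @hom K C (pt y) (pt z), composition_of_length f l.
Proof.
move=> h1 h2; pose m := (y + z - l) / 2.
have my : m <= y by rewrite /m; lra.
have mz : m <= z by rewrite /m; lra.
exists (compm (alpha K I mz) (alpha_star K I my)).
have -> : l = (z - m) + (y - m) by rewrite /m; field.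
exact: composition_comp (composition_alpha_star _) (composition_alpha _).
Qed.

(** The lowest point of the normal form is a function of the end points and of
    the length. *)
Lemma composition_unique (y z : R) (f g : @hom K C (pt y) (pt z)) l :
  composition_of_length f l -> composition_of_length g l -> f = g.
Proof.
move=> cf cg; have [h1 h2] := composition_length_ge cf.
pose m := (y + z - l) / 2.
have my : m <= y by rewrite /m; lra.
have mz : m <= z by rewrite /m; lra.
have e : 2 * m = y + z - l by rewrite /m; field.
rewrite (composition_normal_form cf m my mz e).
by rewrite (composition_normal_form cg m my mz e).
Qed.

Lemma compm0 (x y z : C) (g : hom y z) : compm g (0 : hom x y) = 0.
Proof.
have := comp_linr (-1) g (0 : hom x y) 0.
by rewrite scaler0 addr0 scaleN1r addNr.
Qed.

Lemma comp0m (x y z : C) (f : hom x y) : compm (0 : hom y z) f = 0.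
Proof.
have := comp_linl (-1) (0 : hom y z) 0 f.
by rewrite scaler0 addr0 scaleN1r addNr.
Qed.

Lemma idm_outside y : ~ I y -> idm (pt y : C) = 0.
Proof. by move=> nIy; apply/clsP; exact: teq_outside. Qed.

Lemma through_outside (x z : C) y
    (f : @hom K C x (pt y)) (g : @hom K C (pt y) z) :
  ~ I y -> compm g f = 0.
Proof. by move=> nIy; rewrite -(comp1m f) idm_outside// comp0m compm0. Qed.

(** The path of length [l], with junk value zero when [l] is smaller than the
    distance between the end points. *)
Definition the_path (y z l : R) : @hom K C (pt y) (pt z) :=
  xget 0 [set f | composition_of_length f l].

Lemma the_pathP y z l : y - z <= l -> z - y <= l ->
  composition_of_length (the_path y z l) l.
Proof.
move=> h1 h2; have [f cf] := composition_exists h1 h2.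
by rewrite /the_path; case: xgetP => [g _|/(_ f)].
Qed.

Lemma the_path_unique y z (f : @hom K C (pt y) (pt z)) l :
  composition_of_length f l -> f = the_path y z l.
Proof.
move=> cf; have [h1 h2] := composition_length_ge cf.
exact: composition_unique cf (the_pathP _ _).
Qed.

Lemma the_pathM (u v w l m : R) :
  u - v <= l -> v - u <= l -> v - w <= m -> w - v <= m ->
  compm (the_path v w m) (the_path u v l) = the_path u w (m + l).
Proof.
by move=> *; apply/the_path_unique/composition_comp; exact: the_pathP.
Qed.

Inductive spanned (y z : C) : hom y z -> Prop :=
| spanned_path f l : composition_of_length f l -> spanned f
| spanned0 : spanned 0
| spanned_lin c f g : spanned f -> spanned g -> spanned (c *: f + g).

Lemma spannedM (x y z : C) (g : hom y z) (f : hom x y) :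
  spanned g -> spanned f -> spanned (compm g f).
Proof.
move=> sg; elim=> {f} [f l cf||c f f' _ IH _ IH'].
- elim: sg => {g} [g m cg||c g g' _ IH _ IH'].
  + exact: spanned_path (composition_comp cf cg).
  + by rewrite comp0m; exact: spanned0.
  + by rewrite comp_linl; exact: spanned_lin.
- by rewrite compm0; exact: spanned0.
- by rewrite comp_linr; exact: spanned_lin.
Qed.

(** Generators are paths, and spans of paths are stable under the operations of
    a linear category. *)
Lemma spanned_all (y z : C) (f : hom y z) : spanned f.
Proof.
rewrite -[f]cls_repr; elim: (repr f) => {f y z}.
- by move=> x; apply: (@spanned_path x x _ 0); exact: comp_nil.
- by move=> x y z g IHg f IHf; rewrite -lcompE; exact: spannedM.
- by move=> x y; exact: spanned0.
- move=> x y f IHf g IHg; have := spanned_lin 1 IHf IHg.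
  by rewrite scale1r [_ + _]laddE.
- move=> x y f IHf; have := spanned_lin (-1) IHf (spanned0 _ _).
  by rewrite addr0 scaleN1r [- _]loppE.
- move=> x y c f IHf; have := spanned_lin c IHf (spanned0 _ _).
  by rewrite addr0 [_ *: _]lscaleE.
- by move=> x y h; apply: spanned_path (composition_alpha h).
- by move=> x y h; apply: spanned_path (composition_alpha_star h).
Qed.

End Compositions.

(** * Coefficients of a morphism in the basis of paths *)

Section Coefficients.
Variables (K : fieldType) (R : realType) (a b x : R).
Local Notation I := (open_itv a b).
Local Notation C := (Lambda K I).
Local Notation Hx y := (@hom K C (pt x) y).
Hypothesis Ix : I x.
Local Notation the_path := (@the_path K R I).
Local Notation in_range := (in_range a b x).

(** Such a path can be made to pass through a point outside the interval: its
    lowest point if the bound through [a] fails, its highest point if the one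
    through [b] does. *)
Lemma the_path_out_of_range y l :
  x - y <= l -> y - x <= l -> ~~ in_range (pt y) l -> the_path x y l = 0.
Proof.
move=> h1 h2; rewrite /in_range h1 h2 /= negb_and -!leNgt => /orP[out|out].
(* [w] is the lowest point of the path, reached by descending first. *)
- pose w := (x + y - l) / 2.
  have -> : l = (y - w) + (x - w) by rewrite /w; field.
  rewrite -(@the_pathM _ _ _ x w y) ?through_outside//; rewrite ?/w; try lra.
  by rewrite /open_itv /= in_itv /= => /andP[]; lra.
(* [w] is the highest point of the path, reached by ascending first. *)
- pose w := (x + y + l) / 2.
  have -> : l = (w - y) + (w - x) by rewrite /w; field.
  rewrite -(@the_pathM _ _ _ x w y) ?through_outside//; rewrite ?/w; try lra.
  by rewrite /open_itv /= in_itv /= => /andP[]; lra.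
Qed.

(** The delta function at length zero stands for the identity of [x], so that
    its image under [u] lists the coefficients of [u] in the paths out of
    [x]. *)
Definition lcoef (y : C) (u : Hx y) : R -> K :=
  eval_term a b x (repr u) (fun l => (l == 0)%:R).

Lemma supported_delta : supported a b x (pt x) (fun l => (l == 0)%:R : K).
Proof.
move=> l; case: eqP => // -> /negP[]; apply/and4P.
by move: Ix; rewrite /open_itv /= in_itv /= => /andP[]; split; lra.
Qed.

Lemma lcoef_cls (y : C) (t : term K (pt x) y) :
  lcoef (cls I t) = eval_term a b x t (fun l => (l == 0)%:R).
Proof. exact: eval_term_sound (repr_cls I t) supported_delta. Qed.

Lemma lcoef_lin (y : C) c (u v : Hx y) l :
  lcoef (c *: u + v) l = c * lcoef u l + lcoef v l.
Proof.
rewrite -[in LHS](cls_repr u) -[in LHS](cls_repr v).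
by rewrite [_ *: _ + _]cls_lin lcoef_cls.
Qed.

Lemma lcoef0 (y : C) l : lcoef (0 : Hx y) l = 0.
Proof. by rewrite [0 in LHS]/(lzero K I (pt x) y) lcoef_cls. Qed.

Lemma lcoefZ (y : C) c (u : Hx y) l :
  lcoef (c *: u) l = c * lcoef u l.
Proof. by rewrite -[c *: u]addr0 lcoef_lin lcoef0 addr0. Qed.

Lemma lcoefB (y : C) (u v : Hx y) l :
  lcoef (u - v) l = lcoef u l - lcoef v l.
Proof. by rewrite -scaleN1r addrC lcoef_lin mulN1r addrC. Qed.

Lemma lcoef_sum (y : C) (J : Type) (s : seq J) c (F : J -> Hx y) l :
  lcoef (\sum_(i <- s) c i *: F i) l = \sum_(i <- s) c i * lcoef (F i) l.
Proof.
elim: s => [|i s IH]; first by rewrite !big_nil lcoef0.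
by rewrite !big_cons lcoef_lin IH.
Qed.

Lemma lcoef_in_range (y : C) (u : Hx y) l :
  lcoef u l != 0 -> in_range y l.
Proof.
apply: contraNT => nyl; apply/eqP.
exact: (eval_term_supported (repr u) supported_delta nyl).
Qed.

(** As for the relations, truncation at the intermediate points is implied by
    truncation at the target and by the support of the coefficients of [u]. *)
Lemma lcoef_comp (y : R) (z : C) (g : @hom K C (pt y) z) (u : Hx (pt y)) m l :
  composition_of_length g m ->
  lcoef (compm g u) l = if in_range z l then lcoef u (l - m) else 0.
Proof.
move=> cg; elim: cg u l => {z g m} [|v w vw g m cg IH|v w wv g m cg IH] u l.
- rewrite comp1m subr0; case: ifPn => // nyl; apply/eqP.
  by apply: contraNT nyl; exact: lcoef_in_range.
- rewrite -compA -[compm g u]cls_repr [compm _ _]lcompE lcoef_cls /=.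
  rewrite -/(lcoef (compm g u)) /shift IH ler0_norm ?subr_le0//.
  case: ifP => // /and4P[h1 h2 h3 h4]; case: ifPn => [_|nvl].
    by congr (lcoef u); ring.
  have [k1 k2] := composition_length_ge cg.
  apply/esym/eqP; apply: contraNT nvl => /lcoef_in_range/and4P[m1 m2 m3 m4].
  by apply/and4P; split; lra.
- rewrite -compA -[compm g u]cls_repr [compm _ _]lcompE lcoef_cls /=.
  rewrite -/(lcoef (compm g u)) /shift IH ger0_norm ?subr_ge0//.
  case: ifP => // /and4P[h1 h2 h3 h4]; case: ifPn => [_|nvl].
    by congr (lcoef u); ring.
  have [k1 k2] := composition_length_ge cg.
  apply/esym/eqP; apply: contraNT nvl => /lcoef_in_range/and4P[m1 m2 m3 m4].
  by apply/and4P; split; lra.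
Qed.

Lemma lcoef_path (y : C) (f : Hx y) m l : composition_of_length f m ->
  lcoef f l = (in_range y l && (l == m))%:R.
Proof.
move=> cf; rewrite -(compm1 f) (lcoef_comp _ _ cf).
rewrite [idm _]/(cls I _) lcoef_cls /=.
by case: ifP => //= _; rewrite subr_eq0.
Qed.

Lemma the_path_neq0 y l : in_range (pt y) l -> the_path x y l != 0.
Proof.
move=> yl; move/and4P: (yl) => [h1 h2 h3 h4].
apply/eqP => e0; have /eqP := lcoef_path l (the_pathP K I h1 h2).
by rewrite e0 lcoef0 yl eqxx eq_sym oner_eq0.
Qed.

Lemma path_likeP y (f : Hx (pt y)) l :
  path_like f l <-> in_range (pt y) l /\ f = the_path x y l.
Proof.
split=> [[cf f0]|[yl ->]]; last first.
  by split; [apply: the_pathP; case/and4P: yl|exact: the_path_neq0].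
have [h1 h2] := composition_length_ge cf; have e := the_path_unique cf;
  split=> //.
by apply: contraNT f0 => nyl; rewrite e the_path_out_of_range.
Qed.

(** Quantifying over all finite sets of lengths that contain a given one makes
    the expansion stable under linear combinations. *)
Lemma expansion_exists y (u : Hx (pt y)) : exists s0 : seq R,
  forall s, uniq s -> {subset s0 <= s} ->
  u = \sum_(l <- s) lcoef u l *: the_path x y l.
Proof.
elim: (spanned_all u) => {u} [f m cf||c f g _ [s IHf] _ [t IHg]].
- exists [:: m] => s us sm.
  have ms : m \in s by apply: sm; rewrite inE.
  rewrite (bigD1_seq m)//= big1 ?addr0; last first.
    by move=> l lm; rewrite (lcoef_path l cf) (negPf lm) andbF scale0r.
  rewrite (lcoef_path m cf) eqxx andbT; have -> := the_path_unique cf.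
  case: (boolP (in_range (pt y) m)) => [_|nym]; first by rewrite scale1r.
  by have [h1 h2] := composition_length_ge cf;
    rewrite the_path_out_of_range// scaler0.
- exists [::] => s _ _; rewrite big1// => l _.
  by rewrite lcoef0 scale0r.
- exists (s ++ t) => r ur sr.
  have sf : {subset s <= r} by move=> l ls; apply: sr; rewrite mem_cat ls.
  have tg : {subset t <= r} by move=> l lt; apply: sr; rewrite mem_cat lt orbT.
  rewrite [in LHS](IHf r ur sf) [in LHS](IHg r ur tg).
  rewrite scaler_sumr -big_split; apply: eq_bigr => l _ /=.
  by rewrite lcoef_lin scalerDl scalerA.
Qed.

Lemma expansion y (u : Hx (pt y)) :
  exists2 s : seq R, uniq s & u = \sum_(l <- s) lcoef u l *: the_path x y l.
Proof.
have [s H] := expansion_exists u; exists (undup s); first exact: undup_uniq.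
by apply: H => [|l]; rewrite ?undup_uniq ?mem_undup.
Qed.

Lemma lcoef_eq0 y (u : Hx (pt y)) : (forall l, lcoef u l = 0) -> u = 0.
Proof.
move=> u0; have [s _ ->] := expansion u.
by rewrite big1// => l _; rewrite u0 scale0r.
Qed.

Lemma lcoef_neq0 y (u : Hx (pt y)) : u != 0 -> exists l, lcoef u l != 0.
Proof.
move=> u0; apply: contrapT => nl; move/eqP: u0; apply; apply: lcoef_eq0 => l.
by apply/eqP; apply: contrapT => /negP cl; apply: nl; exists l.
Qed.

End Coefficients.

(** * Submodules, quotients and annihilators over a linear category *)

Section SubmoduleTheory.
Variables (K : fieldType) (C : lincat K) (F : module C) (M : submodule F).

Lemma submodZ y c u : M y u -> M y (c *: u).
Proof. by move=> Mu; have := sub_lin c Mu (sub0 M y); rewrite addr0. Qed.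

Lemma submodD y u v : M y u -> M y v -> M y (u + v).
Proof. by move=> Mu Mv; have := sub_lin 1 Mu Mv; rewrite scale1r. Qed.

Lemma submodB y u v : M y u -> M y v -> M y (u - v).
Proof. by move=> Mu Mv; have := sub_lin (-1) Mv Mu; rewrite scaleN1r addrC. Qed.

End SubmoduleTheory.

Lemma submodule_ext (K : fieldType) (C : lincat K) (F : module C)
    (M M' : submodule F) :
  (forall y u, M y u <-> M' y u) -> M = M'.
Proof.
case: M M' => [M p q r] [M' p' q' r'] /= E.
have e : M = M'.
  by apply/functional_extensionality_dep => y; apply/seteqP; split=> u /E.
by subst M'; congr Submodule; exact: Prop_irrelevance.
Qed.

Section QuotientByM.
Variables (K : fieldType) (C : lincat K) (F : module C) (M : submodule F).

(** The additive group of the quotient of [F y] by [M y], before its scalar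
    multiplication. *)
Definition quo (y : C) := Quotient.quot (@sub_pred K C F M y).
HB.instance Definition _ y := GRing.Zmodule.on (quo y).

Definition quo_pi y (u : F y) : quo y := \pi_(quo y)%qT u.

Lemma quo_piP y (u v : F y) : quo_pi u = quo_pi v <-> M y (u - v).
Proof.
split=> [e|Muv].
  have : (u == v %[mod quo y])%qT by apply/eqP.
  by rewrite -Quotient.idealrBE sub_predE => /asboolP.
by apply/eqP; rewrite -Quotient.idealrBE sub_predE; exact/asboolP.
Qed.

Lemma quo_piD y (u v : F y) : quo_pi (u + v) = quo_pi u + quo_pi v.
Proof. by rewrite /quo_pi raddfD. Qed.

Lemma quo_reprK y (w : quo y) : quo_pi (repr w) = w.
Proof. exact: reprK. Qed.

Definition quo_scale y (c : K) (w : quo y) : quo y := quo_pi (c *: repr w).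

Lemma quo_scaleE y c (u : F y) : quo_scale c (quo_pi u) = quo_pi (c *: u).
Proof.
apply/quo_piP; rewrite -scalerBr; apply: submodZ; apply/quo_piP;
  exact: quo_reprK.
Qed.

Lemma quo_scaleA y c d (w : quo y) :
  quo_scale c (quo_scale d w) = quo_scale (c * d) w.
Proof. by rewrite -(quo_reprK w) !quo_scaleE scalerA. Qed.

Lemma quo_scale1 y : left_id 1 (@quo_scale y).
Proof. by move=> w; rewrite -(quo_reprK w) quo_scaleE scale1r. Qed.

Lemma quo_scaleDr y : right_distributive (@quo_scale y) +%R.
Proof.
move=> c v w; rewrite -(quo_reprK v) -(quo_reprK w) -quo_piD !quo_scaleE.
by rewrite scalerDr quo_piD.
Qed.

Lemma quo_scaleDl y (w : quo y) : {morph (@quo_scale y)^~ w : c d / c + d}.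
Proof. by move=> c d; rewrite -(quo_reprK w) !quo_scaleE scalerDl quo_piD. Qed.

HB.instance Definition _ y := GRing.Zmodule_isLmodule.Build K (quo y)
  (@quo_scaleA y) (@quo_scale1 y) (@quo_scaleDr y) (@quo_scaleDl y).

Lemma quo_pi_linear y : linear (@quo_pi y).
Proof. by move=> c u v; rewrite quo_piD -quo_scaleE. Qed.
HB.instance Definition _ y :=
  GRing.isLinear.Build K (F y) (quo y) *:%R (@quo_pi y) (@quo_pi_linear y).

Definition quo_map y z (f : hom y z) (w : quo y) : quo z :=
  quo_pi (mmap F f (repr w)).

Lemma quo_mapE y z (f : hom y z) u : quo_map f (quo_pi u) = quo_pi (mmap F f u).
Proof.
apply/quo_piP; rewrite -linearB; apply: sub_map; apply/quo_piP;
  exact: quo_reprK.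
Qed.

Lemma quo_map_linear y z (f : hom y z) : linear (quo_map f).
Proof.
move=> c v w; rewrite -(quo_reprK v) -(quo_reprK w) -linearP !quo_mapE.
by rewrite linearP /= linearP.
Qed.
HB.instance Definition _ y z (f : hom y z) :=
  GRing.isLinear.Build K (quo y) (quo z) *:%R (quo_map f) (quo_map_linear f).

Definition quotient_by : module C.
Proof.
refine (@Module K C (fun y => quo y : lmodType K)
  (fun y z f => quo_map f : {linear _ -> _}) _ _ _).
- by move=> y w; rewrite -(quo_reprK w) [LHS]quo_mapE mmap1.
- by move=> y z t g f w; rewrite -(quo_reprK w) /= !quo_mapE mmapM.
- by move=> y z c f g w; rewrite -(quo_reprK w) /= !quo_mapE mmap_lin linearP.
Defined.

Definition quotient_by_proj : modmor F quotient_by.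
Proof.
refine (@Modmor K C F quotient_by (fun y => @quo_pi y : {linear _ -> _}) _).
by move=> y z f u; rewrite /= quo_mapE.
Defined.

Lemma quotient_by_surj y (w : quotient_by y) :
  exists u, quotient_by_proj y u = w.
Proof. by exists (repr w); exact: quo_reprK. Qed.

Definition quotient_of : quotient_module F := QuotientModule quotient_by_surj.

Lemma quotient_of_ker y u : qproj quotient_of y u = 0 <-> M y u.
Proof.
rewrite -(linear0 (qproj quotient_of y)).
by apply: (iff_trans (quo_piP _ _)); rewrite subr0.
Qed.

End QuotientByM.

Section Kernel.
Variables (K : fieldType) (C : lincat K) (F : module C) (N : quotient_module F).

Definition ker_set (y : C) : set (F y) := [set u | qproj N y u = 0].

Lemma ker_set0 y : ker_set (0 : F y).
Proof. exact: linear0. Qed.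

Lemma ker_set_lin y c (u v : F y) : ker_set u -> ker_set v ->
  ker_set (c *: u + v).
Proof. by rewrite /ker_set /= linearP => -> ->; rewrite scaler0 addr0. Qed.

Lemma ker_set_map y z (f : hom y z) (u : F y) : ker_set u ->
  ker_set (mmap F f u).
Proof. by rewrite /ker_set /= mmor_nat => ->; rewrite linear0. Qed.

Definition ker : submodule F := Submodule ker_set0 ker_set_lin ker_set_map.
End Kernel.

Section QuotientIso.
Variables (K : fieldType) (C : lincat K) (F : module C).

Lemma isomodule_refl (G : module C) : isomodule G G.
Proof.
exists (@Modmor K C G G (fun y => idfun : {linear _ -> _})
  (fun y z f v => erefl)).
by move=> y; exists id.
Qed.

(** The induced map on quotients, through an arbitrary choice of preimages. *)
Definition factor (N N' : quotient_module F) y (v : N y) : N' y :=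
  qproj N' y (xget 0 [set u | qproj N y u = v]).

Variables N N' : quotient_module F.
Hypothesis kerN : forall y u, qproj N y u = 0 -> qproj N' y u = 0.

Lemma factorE y u : factor N' (qproj N y u) = qproj N' y u.
Proof.
rewrite /factor; case: xgetP => [w _ /= e|/(_ u erefl)//].
apply/eqP; rewrite -subr_eq0 -linearB; apply/eqP/kerN.
by rewrite linearB e subrr.
Qed.

Lemma factor_linear y : linear (@factor N N' y).
Proof.
move=> c v w; have [u <-] := qproj_surj v; have [t <-] := qproj_surj w.
by rewrite -linearP !factorE linearP.
Qed.
HB.instance Definition _ y :=
  GRing.isLinear.Build K (N y) (N' y) *:%R (@factor N N' y) (@factor_linear y).

Lemma factor_nat y z (f : hom y z) (v : N y) :
  factor N' (mmap N f v) = mmap N' f (factor N' v).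
Proof.
by have [u <-] := qproj_surj v; rewrite -mmor_nat !factorE mmor_nat.
Qed.

Definition factor_mor : modmor N N' :=
  @Modmor K C N N' (fun y => @factor N N' y : {linear _ -> _}) factor_nat.
End QuotientIso.

Lemma ker_iso (K : fieldType) (C : lincat K) (F : module C)
    (N N' : quotient_module F) :
  ker N = ker N' -> isomodule N N'.
Proof.
move=> e.
have k1 y u : qproj N y u = 0 -> qproj N' y u = 0.
  by change (ker N y u -> ker N' y u); rewrite e.
have k2 y u : qproj N' y u = 0 -> qproj N y u = 0.
  by change (ker N' y u -> ker N y u); rewrite e.
exists (factor_mor k1) => y; exists (@factor _ _ _ N' N y) => v /=.
  by have [u <-] := qproj_surj v; rewrite !factorE.
by have [u <-] := qproj_surj v; rewrite !factorE.
Qed.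

(** An isomorphism invariant that is weak enough to be computed and strong
    enough to separate the modules under consideration. *)
Definition same_annihilators (K : fieldType) (C : lincat K) (G H : module C) :=
  forall y z (g : hom y z),
  (forall v, mmap G g v = 0) <-> (forall v, mmap H g v = 0).

Lemma iso_same_annihilators (K : fieldType) (C : lincat K) (G H : module C) :
  isomodule G H -> same_annihilators G H.
Proof.
move=> [phi bij] y z g; split=> ann v.
  have [psi _ phiK] := bij y.
  by rewrite -(phiK v) -mmor_nat ann linear0.
by apply: (bij_inj (bij z)); rewrite mmor_nat ann linear0.
Qed.

(** * Submodules of a representable module are spanned by paths *)

Lemma seq_gap (R : realType) (s : seq R) l0 :
  exists2 e, 0 < e & forall l, l \in s -> l0 < l -> l0 + e <= l.
Proof.
elim: s => [|m s [e e0 IH]]; first by exists 1.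
exists (if l0 < m then Num.min e (m - l0) else e).
  by case: ifPn => // h; rewrite lt_min e0 subr_gt0.
move=> l; rewrite inE => /orP[/eqP ->|/IH{}IH] h.
  by rewrite h -lerBrDl ge_min lexx orbT.
case: ifP => _; last exact: IH.
by apply: le_trans (IH h); rewrite lerD2l ge_min lexx.
Qed.

Lemma seq_min (R : realType) (s : seq R) (p : pred R) l1 : l1 \in s -> p l1 ->
  exists2 l0, p l0 & forall l, l \in s -> p l -> l0 <= l.
Proof.
elim: s l1 => // m s IH l1; rewrite inE => l1s pl1.
case: (boolP (has p s)) => [/hasP[l2 l2s pl2]|/hasPn nps]; last first.
  have pm : p m by case/orP: l1s => [/eqP <- //|/nps /negP].
  exists m => // l; rewrite inE => /orP[/eqP -> //|/nps /negP //].
have [l0 pl0 H] := IH _ l2s pl2.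
case: (boolP (p m && (m < l0))) => [/andP[pm ml0]|n].
  exists m => // l; rewrite inE => /orP[/eqP -> //|ls pl].
  exact: le_trans (ltW ml0) (H _ ls pl).
exists l0 => // l; rewrite inE => /orP[/eqP -> pm|]; last exact: H.
by move: n; rewrite pm /= -leNgt.
Qed.

Section Submodules.
Variables (K : fieldType) (R : realType) (a b x : R).
Local Notation I := (open_itv a b).
Local Notation C := (Lambda K I).
Local Notation Hx y := (@hom K C (pt x) y).
Hypothesis Ix : I x.
Local Notation the_path := (@the_path K R I).
Local Notation in_range := (in_range a b x).
Local Notation P := (P_ K a b x).
Implicit Types (y z : R) (l m s : R).

Definition supp_ge y s (u : Hx (pt y)) := forall l, lcoef u l != 0 -> s <= l.

Lemma finite_support y (u : Hx (pt y)) :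
  exists s : seq R, forall l, lcoef u l != 0 -> l \in s.
Proof.
have [s us e] := expansion Ix u; exists s => l; apply: contraNT => nls.
rewrite e lcoef_sum// big_seq big1// => k ks.
case: (boolP (lcoef u k == 0)) => [/eqP ->|uk]; first by rewrite mul0r.
have /and4P[h1 h2 _ _] := lcoef_in_range Ix uk.
rewrite (lcoef_path Ix l (the_pathP K I h1 h2)).
case: eqP => [lk|_]; first by rewrite lk ks in nls.
by rewrite andbF mulr0.
Qed.

Definition raises y e (n : @hom K C (pt y) (pt y)) :=
  forall s (v : Hx (pt y)), supp_ge s v ->
  supp_ge (s + e) (compm n v).

(** Each path that occurs in [w] is the path of length [l0] followed by a loop
    at [y] of length at least [e], and following by such a loop raises all
    lengths by at least [e]. *)
Lemma higher_multiple y l0 e (w : Hx (pt y)) :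
  x - y <= l0 -> y - x <= l0 -> 0 <= e -> supp_ge (l0 + e) w ->
  exists2 n, w = compm n (the_path x y l0) & raises e n.
Proof.
move=> h1 h2 e0 aw; have [s _ Ew] := expansion Ix w.
pose Q (v : Hx (pt y)) :=
  exists2 n, v = compm n (the_path x y l0) & raises e n.
have Q0 : Q 0.
  exists 0; first by rewrite comp0m.
  by move=> t v _ l; rewrite comp0m lcoef0// eqxx.
have Qlin c u v : Q u -> Q v -> Q (c *: u + v).
  move=> [n -> Hn] [m -> Hm]; exists (c *: n + m); first by rewrite comp_linl.
  move=> t w' aw' l; rewrite comp_linl lcoef_lin// => nz.
  case: (eqVneq (lcoef (compm n w') l) 0) => [z0|]; last exact: Hn.
  by move: nz; rewrite z0 mulr0 add0r; exact: Hm.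
suff : Q w by [].
rewrite Ew; apply: (big_ind Q) => // [u v Qu Qv|l _].
  by rewrite -[u]scale1r; exact: Qlin.
case: (eqVneq (lcoef w l) 0) => [->|/aw le0l]; first by rewrite scale0r.
rewrite -[_ *: _]addr0; apply: Qlin => //; exists (the_path y y (l - l0)).
  by rewrite the_pathM ?subrK//; lra.
move=> t v av k; rewrite (lcoef_comp Ix _ _ (the_pathP K I _ _)); try lra.
by case: ifP; rewrite ?eqxx// => _ /av; lra.
Qed.

Lemma supp_ge_eq0 y s (u : Hx (pt y)) :
  x + y - 2 * a <= s -> supp_ge s u -> u = 0.
Proof.
move=> hs au; apply: lcoef_eq0 => // l; apply/eqP/negPn/negP => nz.
by have /and4P[_ _ h _] := lcoef_in_range Ix nz; have := au _ nz; lra.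
Qed.

(** Write [u] as [c] times [p + n p] where [p] is the path of length [l0] and
    [n] raises lengths by [e > 0]. The partial sums of the Neumann series of
    [1 + n], applied to [c^-1 u], lie in [M] and approach [p] up to terms of
    length at least [l0 + k e], which vanish for [k] large. *)
Lemma leading_path (M : submodule P) y (u : Hx (pt y)) l0 :
  M (pt y) u -> lcoef u l0 != 0 -> supp_ge l0 u -> M (pt y) (the_path x y l0).
Proof.
move=> Mu c0 au; set p := the_path x y l0; set c := lcoef u l0.
have l0i := lcoef_in_range Ix c0; have /and4P[h1 h2 _ _] := l0i.
have [s us] := finite_support u; have [e e0 gap] := seq_gap s l0.
(* The part of the normalized morphism above its leading path. *)
pose w := c^-1 *: u - p.
have lcoefw l : lcoef w l = c^-1 * lcoef u l -
  (in_range (pt y) l && (l == l0))%:R.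
  by rewrite /w lcoefB// lcoefZ// (lcoef_path Ix l (the_pathP K I h1 h2)).
have aw : supp_ge (l0 + e) w.
  move=> l; rewrite lcoefw; case: (eqVneq l l0) => [->|ll0].
    by rewrite l0i /= mulVf// subrr eqxx.
  rewrite andbF subr0 mulf_eq0 negb_or => /andP[_ nz].
  by apply: gap; [exact: us|rewrite lt_neqAle eq_sym ll0; exact: au].
have [n wn Hn] := higher_multiple h1 h2 (ltW e0) aw.
have approx k : exists2 v, M (pt y) v & supp_ge (l0 + e * k%:R) (v - p).
  elim: k => [|k [v Mv av]].
    exists 0; first exact: sub0.
    move=> l; rewrite lcoefB// lcoef0// (lcoef_path Ix l (the_pathP K I h1 h2)).
    by case: (l =P l0) => [->|_]; rewrite ?mulr0 ?addr0// andbF subr0 eqxx.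
  (* The next partial sum; its error is minus [n] applied to the previous
     one. *)
  exists (c^-1 *: u - compm n v).
    by apply: submodB; [exact: submodZ|exact: (sub_map n Mv)].
  have -> : c^-1 *: u - compm n v - p = 0 - compm n (v - p).
    have -> : compm n (v - p) = compm n v - w.
      by rewrite wn -scaleN1r addrC comp_linr addrC scaleN1r.
    by rewrite /w sub0r opprB addrAC.
  move=> l; rewrite lcoefB// lcoef0// sub0r oppr_eq0 => nz.
  by have := Hn _ _ av _ nz; rewrite -natr1; lra.
pose k := Num.bound ((`|x + y - 2 * a| + `|l0|) / e).
have [v Mv av] := approx k.
suff /eqP : v - p = 0 by rewrite subr_eq0 => /eqP <-.
apply: supp_ge_eq0 av.
have : (`|x + y - 2 * a| + `|l0|) / e < k%:R.
  by rewrite /k; apply: archi_boundP; apply: divr_ge0;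
    [exact: addr_ge0|exact: ltW].
rewrite ltr_pdivrMr// => H.
by have := ler_norm (x + y - 2 * a); have := ler_norm (- l0); rewrite normrN;
  lra.
Qed.

(** A path of length [m] from [y] to [z] acts on paths by addition of
    lengths. *)
Lemma path_up (M : submodule P) y z l m : x - y <= l -> y - x <= l ->
  y - z <= m -> z - y <= m ->
  M (pt y) (the_path x y l) -> M (pt z) (the_path x z (m + l)).
Proof.
move=> h1 h2 h3 h4 My; rewrite -(@the_pathM _ _ _ x y z)//.
exact: (sub_map (the_path y z m) My).
Qed.

(** The shortest path of a morphism in [M] belongs to [M], and each other path
    that occurs in it is that one followed by a loop. *)
Lemma mem_submodule (M : submodule P) y (u : Hx (pt y)) :
  M (pt y) u <-> forall l, lcoef u l != 0 -> M (pt y) (the_path x y l).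
Proof.
split=> [Mu l1 l1u|H]; last first.
  have [s _ ->] := expansion Ix u.
  apply: (big_ind (fun v => M (pt y) v)) => [|v w|l _];
    [exact: sub0|exact: submodD|].
  case: (eqVneq (lcoef u l) 0) => [->|/H Hl]; last exact: submodZ.
  by rewrite scale0r; exact: sub0.
have [s us] := finite_support u.
have [l0 l0u minl0] := @seq_min _ s (fun l => lcoef u l != 0) _ (us _ l1u) l1u.
have al0 : supp_ge l0 u by move=> l lu; exact: minl0 (us _ lu) lu.
have Ml0 := leading_path Mu l0u al0.
have /and4P[h1 h2 _ _] := lcoef_in_range Ix l0u.
rewrite -(subrK l0 l1); apply: path_up Ml0 => //.
all: by have := al0 _ l1u; lra.
Qed.

End Submodules.

(** * Submodules cut out by a function, and admissible functions *)

(** Applied to the lengths of nonzero paths, and to those of the paths that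
    survive in a decorous quotient. *)
Lemma sup_half_open (R : realType) (m t : R) : m < t ->
  sup [set l | m <= l < t] = t.
Proof.
move=> mt; apply/eqP; rewrite eq_le; apply/andP; split.
  by apply: ge_sup => [|l /andP[_ /ltW]//]; exists m; rewrite /= lexx.
rewrite leNgt; apply/negP => st; set s := sup _ in st.
have ub : ubound [set l | m <= l < t] s.
  by apply: ub_le_sup; exists t => l /andP[_ /ltW].
have ms : m <= s by apply: ub; rewrite /= lexx.
have : (s + t) / 2 <= s by apply: ub; rewrite /=; apply/andP; split; lra.
lra.
Qed.

Lemma inf_min (R : realType) (E : set R) m : E m -> lbound E m -> inf E = m.
Proof.
move=> Em lb; apply/eqP; rewrite eq_le; apply/andP; split.
  by apply: ge_inf => //; exists m.
by apply: lb_le_inf => //; exists m.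
Qed.

Section Cuts.
Variables (K : fieldType) (R : realType) (a b x : R).
Local Notation I := (open_itv a b).
Local Notation C := (Lambda K I).
Local Notation Hx y := (@hom K C (pt x) y).
Hypothesis Ix : I x.
Local Notation the_path := (@the_path K R I).
Local Notation in_range := (in_range a b x).
Local Notation P := (P_ K a b x).
Local Notation closure := (closure_itv a b).
Implicit Types (l m s : R) (d : closure -> R) (M : submodule P).

Definition minlen (y : R) := `|x - y|.
Definition suplen (y : R) := Num.min (x + y - 2 * a) (2 * b - x - y).

Lemma in_rangeE y l : in_range (pt y) l = (minlen y <= l < suplen y).
Proof.
apply/and4P/andP; rewrite /minlen /suplen lt_min ler_norml.
  by case=> h1 h2 h3 h4; split; apply/andP; split; lra.
by case=> /andP[h1 h2] /andP[h3 h4]; split; lra.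
Qed.

Lemma the_path_minlen y l : minlen y <= l ->
  composition_of_length (the_path x y l) l.
Proof. by rewrite /minlen ler_norml => /andP[h1 h2]; apply: the_pathP; lra. Qed.

Lemma open_itvP y : I y <-> a < y < b.
Proof. by rewrite /open_itv /= in_itv. Qed.

Lemma closure_le (y : closure) : a <= val y <= b.
Proof. by case: y => y /=; rewrite in_itv. Qed.

Lemma minlen_suplen (y : closure) : minlen (val y) <= suplen (val y).
Proof.
move/open_itvP: Ix => /andP[ax xb]; have /andP[ay yb] := closure_le y.
rewrite /minlen /suplen le_min !ler_norml; apply/andP; split; apply/andP;
  split; lra.
Qed.

Lemma minlen_lt y : I y -> minlen y < suplen y.
Proof.
move/open_itvP: Ix => /andP[ax xb] /open_itvP/andP[ay yb].
rewrite /minlen /suplen lt_min !ltr_norml; apply/andP; split; apply/andP;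
  split; lra.
Qed.

(** At the end points of the interval there is no nonzero path, so that the
    range of lengths degenerates to the prescribed boundary value. *)
Lemma minlen_eq_suplen (y : closure) :
  ~ I (val y) -> minlen (val y) = suplen (val y).
Proof.
move=> nIy; apply/eqP; rewrite eq_le minlen_suplen /= leNgt; apply/negP => lt.
by apply: nIy; apply: (@in_range_itv _ a b x _ (minlen (val y)));
  rewrite in_rangeE lexx.
Qed.

Lemma closure_mem y : I y -> y \in `[a, b].
Proof. by move=> /open_itvP/andP[ay yb]; rewrite in_itv /= !ltW. Qed.

Lemma minlen_a : minlen a = x - a.
Proof. by case/open_itvP/andP: Ix => ax _;
  rewrite /minlen gtr0_norm ?subr_gt0. Qed.

Lemma minlen_b : minlen b = b - x.
Proof.
by case/open_itvP/andP: Ix => _ xb; rewrite /minlen ltr0_norm ?subr_lt0// opprB.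
Qed.

(** Attaining the threshold is built in, which is decorousness of a submodule
    and, for the kernel, decorousness of a quotient. The bounds make [d y]
    unique also where no path or every path belongs to [M]; at the end points
    they leave a single value. *)
Definition cut M d := forall y : closure,
  minlen (val y) <= d y <= suplen (val y) /\
  forall l, in_range (pt (val y)) l ->
    M (pt (val y)) (the_path x (val y) l) <-> d y <= l.

Lemma path_up_in M y z l m : minlen y <= l -> `|y - z| <= m ->
  M (pt y) (the_path x y l) -> M (pt z) (the_path x z (m + l)).
Proof.
rewrite /minlen !ler_norml => /andP[? ?] /andP[? ?].
by apply: path_up; lra.
Qed.

Lemma suplen_lip y z : suplen z <= suplen y + `|y - z|.
Proof.
have := ler_norm (y - z); have := ler_norm (- (y - z)); rewrite normrN => h1 h2.
by rewrite -lerBlDr le_min !lerBlDr !ge_min; apply/andP; split; apply/orP;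
  [left|right]; lra.
Qed.

(** Following the path of length [d y] by a path of length [`|y - z|] gives an
    element of [M] at [z], or a path whose length exceeds the range at [z]. If
    [M] is zero at [y], the bound is the one satisfied by [suplen]. *)
Lemma cut_lip M d (y z : closure) : cut M d -> d z <= d y + `|val y - val z|.
Proof.
move=> cM; have [/andP[my sy] My] := cM y; have [/andP[mz sz] Mz] := cM z.
case: (ltP (d y) (suplen (val y))) => h; last first.
  by apply: (le_trans sz); apply: (le_trans (suplen_lip (val y) _));
    rewrite lerD2r.
have yin : in_range (pt (val y)) (d y) by rewrite in_rangeE my h.
have Mp := path_up_in my (lexx `|val y - val z|) ((My _ yin).2 (lexx _)).
case: (boolP (in_range (pt (val z)) (`|val y - val z| + d y))) => zin.
  by rewrite addrC; exact: (Mz _ zin).1.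
move: zin; rewrite in_rangeE negb_and => /orP[|].
  rewrite /minlen; have -> : x - val z = (x - val y) + (val y - val z) by ring.
  have := ler_normD (x - val y) (val y - val z).
  by rewrite /minlen in my; rewrite -ltNge => h1 h2; lra.
by rewrite -leNgt addrC; exact: le_trans.
Qed.

Lemma cut_admissible M d : cut M d -> admissible x d.
Proof.
move=> cM.
have H y : minlen (val y) <= d y <= suplen (val y) by have [] := cM y.
have He (y : closure) : ~ I (val y) -> d y = minlen (val y).
  move=> /minlen_eq_suplen e; apply/eqP; rewrite eq_le.
  by have /andP[h1 h2] := H y; rewrite h1 e h2.
split.
- by move=> y; have /andP[h _] := H y; exact: le_trans (normr_ge0 _) h.
- by move=> y ya; rewrite He ya ?minlen_a// => /open_itvP; rewrite ltxx.
- by move=> y yb; rewrite He yb ?minlen_b// => /open_itvP; rewrite ltxx andbF.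
- move=> y z _; rewrite ler_norml.
  have h1 := cut_lip y z cM; have h2 := cut_lip z y cM.
  by rewrite distrC in h2; apply/andP; split; lra.
Qed.

Lemma admissible_lip d : admissible x d -> forall y z,
  d z <= d y + `|val y - val z|.
Proof.
move=> [_ _ _ lip] y z; have [->|/eqP yz] := eqVneq y z.
  by rewrite subrr normr0 addr0.
by have := lip y z yz; rewrite ler_norml => /andP[]; lra.
Qed.

(** The Lipschitz condition between [y] and each end point gives two upper and
    two lower bounds; together they are [suplen y] and [minlen y]. *)
Lemma admissible_bounds d (y : closure) :
  admissible x d -> minlen (val y) <= d y <= suplen (val y).
Proof.
move=> ad; have lip := admissible_lip ad; case: ad => _ da db _.
move/open_itvP: Ix => /andP[ax xb]; have /andP[ay yb] := closure_le y.
have ab : a <= b by lra.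
have ma : a \in `[a, b] by rewrite in_itv /= lexx.
have mb : b \in `[a, b] by rewrite in_itv /= lexx andbT.
(* The end points, as elements of the domain of [d]. *)
pose A : closure := exist _ a ma; pose B : closure := exist _ b mb.
have := lip A y; have := lip y A; have := lip B y; have := lip y B.
rewrite (da A erefl) (db B erefl) /=.
rewrite [`|val y - b|]ler0_norm ?subr_le0// [`|b - val y|]ger0_norm ?subr_ge0//.
rewrite [`|val y - a|]ger0_norm ?subr_ge0// [`|a - val y|]ler0_norm ?subr_le0//.
move=> h1 h2 h3 h4; rewrite /minlen /suplen le_min ler_norml.
by rewrite -[sval y]/(val y); apply/andP; split; apply/andP; split; lra.
Qed.

(** The submodule spanned at each [y] by the paths of length at least [d y]. The
    quantification over points of the closed interval that lie at [y] extends
    [d] to all reals; the objects where it is vacuous are zero. *)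
Definition supp_ge_set d (y : C) : set (P y) :=
  if y is pt y return set (P y) then
    fun u => forall (y' : closure), val y' = y -> supp_ge (d y') u
  else setT.

Lemma hom_to_zero (y : C) (u : @hom K C y zero_pt) : u = 0.
Proof.
rewrite -(comp1m u); have -> : idm (zero_pt : C) = 0 by exact/clsP/teq_zero_pt.
exact: comp0m.
Qed.

Lemma supp_ge_set0 d y : @supp_ge_set d y 0.
Proof. by case: y => //= y y' _ l; rewrite lcoef0// eqxx. Qed.

Lemma supp_ge_set_lin d y c (u v : P y) :
  supp_ge_set d u -> supp_ge_set d v -> supp_ge_set d (c *: u + v).
Proof.
case: y u v => //= y u v au av y' e l; rewrite lcoef_lin// => nz.
case: (eqVneq (lcoef u l) 0) => [z0|]; last exact: au.
by move: nz; rewrite z0 mulr0 add0r; exact: av.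
Qed.

Lemma supp_ge_set_map d (y z : C) (f : hom y z) (u : P y) : admissible x d ->
  supp_ge_set d u -> supp_ge_set d (mmap P f u).
Proof.
move=> ad; have lip := admissible_lip ad; case: y f u => [|y] f u.
  by rewrite (hom_to_zero u) linear0 => _; exact: supp_ge_set0.
move=> au; elim: (spanned_all f) => {f} [f m cf||c f g _ IHf _ IHg].
- case: z f cf => // z f cf z' e l.
  change (lcoef (@compm K C (pt x) (pt y) (pt z) f u) l != 0 -> d z' <= l).
  rewrite (lcoef_comp Ix _ _ cf).
  case: ifP => [_ nz|]; last by rewrite eqxx.
  have Iy := in_range_itv (lcoef_in_range Ix nz).
  pose y' : closure := exist _ y (closure_mem Iy).
  have h := au y' erefl _ nz; have [k1 k2] := composition_length_ge cf.
  have k : `|val y' - val z'| <= m.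
    by rewrite e /= ler_norml; apply/andP; split; lra.
  by have := lip y' z'; lra.
- have -> : mmap P (0 : @hom K C (pt y) z) u = 0 by exact: (@comp0m K R I).
  exact: supp_ge_set0.
- by rewrite mmap_lin; exact: supp_ge_set_lin.
Qed.

Lemma admissible_cut d : admissible x d -> exists M, cut M d.
Proof.
move=> ad.
exists (Submodule (@supp_ge_set0 d) (@supp_ge_set_lin d)
  (fun y z f u => @supp_ge_set_map d y z f u ad)).
move=> y; split; first exact: admissible_bounds.
move=> l yl; have /andP[h1 h2] : minlen (val y) <= l < suplen (val y).
  by rewrite -in_rangeE.
have cl k := lcoef_path Ix k (the_path_minlen h1).
split=> [/(_ y erefl l)|dl y' /val_inj -> k].
  by apply; rewrite cl yl eqxx oner_eq0.
by rewrite cl; case: (k =P l) => [->//|_]; rewrite andbF eqxx.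
Qed.

(** A submodule is determined by the paths in it. *)
Lemma cut_inj d M M' : cut M d -> cut M' d -> M = M'.
Proof.
move=> cM cM'.
apply: submodule_ext => -[|y] u.
  by rewrite (hom_to_zero u); split=> _; exact: sub0.
rewrite !(mem_submodule Ix).
suff H l : lcoef u l != 0 -> M (pt y) (the_path x y l) <->
  M' (pt y) (the_path x y l).
  by split=> Mu l lu; apply/(H l lu)/Mu.
move=> /(lcoef_in_range Ix) yl.
pose y' : closure := exist _ y (closure_mem (in_range_itv yl)).
exact: iff_trans ((cM y').2 l yl) (iff_sym ((cM' y').2 l yl)).
Qed.

End Cuts.

(** * The boundary functions of decorous submodules and quotients *)

Section Decorous.
Variables (K : fieldType) (R : realType) (a b x : R).
Local Notation I := (open_itv a b).
Local Notation C := (Lambda K I).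
Local Notation Hx y := (@hom K C (pt x) y).
Hypothesis Ix : I x.
Local Notation the_path := (@the_path K R I).
Local Notation in_range := (in_range a b x).
Local Notation P := (P_ K a b x).
Local Notation closure := (closure_itv a b).
Local Notation minlen := (minlen x).
Local Notation suplen := (suplen a b x).
Implicit Types (l m s : R) (d : closure -> R) (M : submodule P).
Implicit Types (N : quotient_module P).

(** The shape of the conclusion is the common outer part of the two boundary
    functions. *)
Lemma end_value (y : closure) (t : R) : ~ I (val y) ->
  (if val y == a then x - a else if val y == b then b - x else t) = minlen
    (val y).
Proof.
move=> nIy; case: eqP => [->|/eqP ya]; first by rewrite (minlen_a Ix).
case: eqP => [->|/eqP yb]; first by rewrite (minlen_b Ix).
exfalso; apply: nIy; apply/open_itvP; have /andP[h1 h2] := closure_le y.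
by rewrite !lt_neqAle h1 h2 eq_sym ya yb.
Qed.

Lemma inner_value (y : closure) (t : R) : I (val y) ->
  (if val y == a then x - a else if val y == b then b - x else t) = t.
Proof. by move/open_itvP => /andP[h1 h2]; rewrite gt_eqF// lt_eqF. Qed.

Lemma outside_cut M (y : closure) (t : R) : ~ I (val y) -> t = minlen (val y) ->
  minlen (val y) <= t <= suplen (val y) /\
  forall l, in_range (pt (val y)) l ->
    M (pt (val y)) (the_path x (val y) l) <-> t <= l.
Proof.
move=> nIy ->; rewrite lexx minlen_suplen//; split=> // l.
by rewrite not_in_range.
Qed.

Lemma hom_lengthsE (y : R) :
  hom_lengths K I x y = [set l | minlen y <= l < suplen y].
Proof.
apply/seteqP; split=> l /=; rewrite -in_rangeE;
  first by case=> f /(path_likeP Ix) [].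
by move=> yl; exists (the_path x y l); apply/(path_likeP Ix).
Qed.

Lemma sup_hom_lengths y : I y -> sup (hom_lengths K I x y) = suplen y.
Proof. by move=> Iy; rewrite hom_lengthsE sup_half_open// minlen_lt. Qed.

Lemma inf_hom_lengths y : I y -> inf (hom_lengths K I x y) = minlen y.
Proof.
move=> Iy; rewrite hom_lengthsE; apply: inf_min => [|l /andP[]//].
by rewrite /= lexx minlen_lt.
Qed.

Lemma sub_lengthsP M y l :
  sub_lengths M y l <-> in_range (pt y) l /\ M (pt y) (the_path x y l).
Proof.
split=> [[f [Mf /(path_likeP Ix) [yl e]]]|[yl Ml]]; first by rewrite -e.
by exists (the_path x y l); split=> //; apply/(path_likeP Ix).
Qed.

Lemma sub_nonzeroP M y : sub_nonzero M y <-> exists l, sub_lengths M y l.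
Proof.
split=> [[f [Mf /(lcoef_neq0 Ix) [l fl]]]|[l /sub_lengthsP[yl Ml]]].
  exists l; apply/sub_lengthsP; split; first exact: lcoef_in_range fl.
  by move/(mem_submodule Ix): Mf; apply.
by exists (the_path x y l); split=> //; exact: the_path_neq0.
Qed.

(** The infimum of the lengths in [M] is attained by decorousness, and
    everything longer follows because [M] is up-closed. Where [M] is zero the
    threshold is [suplen], which no nonzero path reaches. *)
Lemma decorous_sub_cut M : decorous_sub M -> cut M (del_up M).
Proof.
move=> dM y; have [Iy|nIy] := pselect (I (val y)); last first.
  by apply: outside_cut => //; exact: end_value.
have := dM y Iy; rewrite /del_up inner_value//; case: asboolP => nz.
  move=> /(_ nz) /sub_lengthsP; set m := inf _ => -[ym Mm].
  have /andP[h1 h2] : minlen (val y) <= m < suplen (val y).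
    by rewrite -in_rangeE.
  split=> [|l yl]; first by rewrite h1 ltW.
  split=> [Ml|ml].
    apply: ge_inf; last by apply/sub_lengthsP.
    by exists (minlen (val y)) => k /sub_lengthsP[];
      rewrite in_rangeE => /andP[].
  rewrite -(subrK m l); apply: path_up_in Mm => //.
  by rewrite subrr normr0 subr_ge0.
move=> _; rewrite sup_hom_lengths//; split=> [|l yl].
  by rewrite lexx andbT ltW// minlen_lt.
split=> [Ml|].
  by case: nz; apply/sub_nonzeroP; exists l; apply/sub_lengthsP.
by move: yl; rewrite in_rangeE => /andP[_]; rewrite ltNge => /negP.
Qed.

Lemma cut_decorous_sub M d : cut M d -> decorous_sub M /\ del_up M = d.
Proof.
move=> cM.
have lenP y l : sub_lengths M (val y) l <-> d y <= l < suplen (val y).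
  have [/andP[h1 h2] H] := cM y; rewrite sub_lengthsP; split.
    by case=> yl /(H l yl) ->; move: yl; rewrite in_rangeE => /andP[].
  move=> /andP[dl ls]; have yl : in_range (pt (val y)) l.
    by rewrite in_rangeE ls andbT (le_trans h1).
  by split=> //; apply/(H l yl).
have E y : del_up M y = d y.
  have [/andP[h1 h2] _] := cM y.
  have [Iy|nIy] := pselect (I (val y)); last first.
    rewrite /del_up end_value//; apply/eqP; rewrite eq_le h1 /=.
    by rewrite minlen_eq_suplen.
  rewrite /del_up inner_value//;
    case: asboolP => [/sub_nonzeroP [l /lenP /andP[dl ls]]|nz].
    apply: inf_min; first by apply/lenP; rewrite lexx (le_lt_trans dl).
    by move=> k /lenP/andP[].
  rewrite sup_hom_lengths//; apply/eqP; rewrite eq_le h2 andbT leNgt;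
    apply/negP => ds.
  by apply: nz; apply/sub_nonzeroP; exists (d y); apply/lenP; rewrite lexx.
split; last exact/funext.
move=> y Iy /sub_nonzeroP [l /lenP /andP[dl ls]]; rewrite E; apply/lenP.
by rewrite lexx (le_lt_trans dl).
Qed.

(** A loop of length [suplen - d' y] at [y] kills [M'] at [y]. Were [d y]
    smaller than [d' y], the path of length [d y] in [M] would survive it. *)
Lemma sub_iso_le M M' d d' (y : closure) : cut M d -> cut M' d' ->
  same_annihilators (sub_module M) (sub_module M') -> d' y <= d y.
Proof.
move=> cM cM' sameA; rewrite leNgt; apply/negP => lt.
have [/andP[h1 h2] H] := cM y; have [/andP[k1 k2] H'] := cM' y.
set z := val y in h1 h2 H k1 k2 H'.
pose t := suplen z - d' y.
have ct : composition_of_length (the_path z z t) t.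
  by apply: the_pathP; rewrite subrr subr_ge0.
have yd : in_range (pt z) (d y) by rewrite in_rangeE h1 (lt_le_trans lt).
have Mp : the_path x z (d y) \in @sub_pred K C P M (pt z).
  by apply/asboolP; exact/(H _ yd).
have kill : forall v : sub_module M' (pt z),
  mmap (sub_module M') (the_path z z t) v = 0.
  case=> u Mu.
  apply/val_inj => /=; apply: lcoef_eq0 => // l.
  change (lcoef (@compm K C (pt x) (pt z) (pt z) (the_path z z t) u) l = 0).
  rewrite (lcoef_comp Ix _ _ ct); case: ifP => // zl;
    apply/eqP/negPn/negP => nz.
  move/asboolP/(mem_submodule Ix)/(_ _ nz): Mu.
  move=> /(H' _ (lcoef_in_range Ix nz)); rewrite /t.
  by move: zl; rewrite in_rangeE => /andP[_ zl] ?; lra.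
have /(congr1 val) := (sameA _ _ (the_path z z t)).2 kill
  (exist (fun u => u \in @sub_pred K C P M (pt z)) _ Mp : sub_type M (pt z)).
change (@compm K C (pt x) (pt z) (pt z) (the_path z z t) (the_path x z (d y))
  = 0 -> False).
move=> e; have := lcoef_comp Ix (the_path x z (d y)) (t + d y) ct.
rewrite e lcoef0//.
have zin : in_range (pt z) (t + d y).
  by rewrite in_rangeE /t; apply/andP; split; lra.
rewrite zin addrAC subrr add0r (lcoef_path Ix _ (the_path_minlen K a b h1)).
by rewrite yd eqxx => /esym/eqP; rewrite oner_eq0.
Qed.

Lemma quot_lengthsP N y l :
  quot_lengths N y l <-> in_range (pt y) l /\ ~ ker N (pt y) (the_path x y l).
Proof.
split=> [[v [v0 [f [/(path_likeP Ix) [yl ->] e]]]]|[yl Nl]].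
  by split=> // k; move/eqP: v0; rewrite -e; apply.
exists (qproj N (pt y) (the_path x y l)); split; first exact/eqP.
by exists (the_path x y l); split=> //; apply/(path_likeP Ix).
Qed.

Lemma quot_nonzeroP N y : quot_nonzero N y <-> exists l, quot_lengths N y l.
Proof.
split=> [[v v0]|[l [v [v0 _]]]]; last by exists v.
have [u e] := qproj_surj v; apply: contrapT => nl.
suff : ker N (pt y) u by move=> k; move/eqP: v0; rewrite -e; apply.
apply/(mem_submodule Ix) => l ul; apply: contrapT => k; apply: nl; exists l.
by apply/quot_lengthsP; split=> //; exact: lcoef_in_range ul.
Qed.

(** Below the supremum of the surviving lengths no path is in the kernel, since
    the kernel is up-closed; above it every path is; and the supremum itself is
    in the kernel by decorousness. *)
Lemma decorous_quot_cut N : decorous_quot N -> cut (ker N) (del_down N).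
Proof.
move=> dN y; have [Iy|nIy] := pselect (I (val y)); last first.
  by apply: outside_cut => //; exact: end_value.
have := dN y Iy; rewrite /del_down inner_value//; case: asboolP => nz.
  set L := quot_lengths N (val y); set m := sup _ => nm.
  have L0 : L !=set0 by have [l Ll] := (quot_nonzeroP N (val y)).1 nz; exists l.
  have Lb : ubound L (suplen (val y)).
    by move=> k /quot_lengthsP[]; rewrite in_rangeE => /andP[_ /ltW].
  have Lm : ubound L m by apply: ub_le_sup; exists (suplen (val y)).
  split.
    apply/andP; split; last exact: ge_sup.
    have [l Ll] := L0; apply: le_trans (Lm _ Ll).
    by move/quot_lengthsP: Ll => []; rewrite in_rangeE => /andP[].
  move=> l yl; split=> [Kl|ml].
    rewrite leNgt; apply/negP => /(sup_gt L0) [k Lk lk].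
    move/quot_lengthsP: Lk => [_]; apply; rewrite -(subrK l k).
    apply: path_up_in Kl; first by move: yl; rewrite in_rangeE => /andP[].
    by rewrite subrr normr0 subr_ge0 ltW.
  apply: contrapT => Kl; have Ll : L l by apply/quot_lengthsP.
  by apply: nm; rewrite (_ : m = l)//; apply/eqP; rewrite eq_le ml Lm.
move=> _; rewrite inf_hom_lengths//; split=> [|l yl].
  by rewrite lexx ltW// minlen_lt.
split=> [_|_]; first by move: yl; rewrite in_rangeE => /andP[].
apply: contrapT => Kl; apply: nz; apply/quot_nonzeroP; exists l.
exact/quot_lengthsP.
Qed.

Lemma cut_decorous_quot N d : cut (ker N) d ->
  decorous_quot N /\ del_down N = d.
Proof.
move=> cN.
have lenE y : quot_lengths N (val y) = [set l | minlen (val y) <= l < d y].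
  have [/andP[h1 h2] H] := cN y; apply/seteqP; split=> l /=.
    case/quot_lengthsP => yl nk.
    move: (yl); rewrite in_rangeE => /andP[-> _] /=.
    by rewrite ltNge; apply/negP => dl; apply: nk; apply/(H l yl).
  move=> /andP[ml ld]; have yl : in_range (pt (val y)) l.
    by rewrite in_rangeE ml (lt_le_trans ld).
  by apply/quot_lengthsP; split=> // /(H l yl); rewrite leNgt ld.
have E y : del_down N y = d y.
  have [/andP[h1 h2] _] := cN y.
  have [Iy|nIy] := pselect (I (val y)); last first.
    rewrite /del_down end_value//; apply/eqP; rewrite eq_le h1 /=.
    by rewrite minlen_eq_suplen.
  rewrite /del_down inner_value//; case: asboolP => [/quot_nonzeroP [l]|nz].
    rewrite lenE => /andP[ml ld]; rewrite sup_half_open//;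
      exact: le_lt_trans ld.
  rewrite inf_hom_lengths//; apply/eqP; rewrite eq_le h1 leNgt;
    apply/negP => lt.
  by apply: nz; apply/quot_nonzeroP; exists (minlen (val y));
    rewrite lenE /= lexx.
split; last exact/funext.
by move=> y _; rewrite E lenE /= ltxx andbF.
Qed.

(** A loop of length [d y - minlen y] at [y] maps every path into the kernel of
    [N]. Were [d y] smaller than [d' y], it would map the shortest path to one
    that is nonzero in [N']. *)
Lemma quot_iso_le N N' d d' (y : closure) : cut (ker N) d -> cut (ker N') d' ->
  same_annihilators N N' -> d' y <= d y.
Proof.
move=> cN cN' sameA; rewrite leNgt; apply/negP => lt.
have [/andP[h1 h2] H] := cN y; have [/andP[k1 k2] H'] := cN' y.
set z := val y in h1 h2 H k1 k2 H'.
pose t := d y - minlen z.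
have ct : composition_of_length (the_path z z t) t.
  by apply: the_pathP; rewrite subrr subr_ge0.
have yd : in_range (pt z) (d y) by rewrite in_rangeE h1 (lt_le_trans lt).
suff : ker N' (pt z) (the_path x z (d y)) by move/(H' _ yd); rewrite leNgt lt.
have -> : the_path x z (d y) =
    @compm K C (pt x) (pt z) (pt z) (the_path z z t) (the_path x z (minlen z)).
  have cz := the_path_minlen K a b (lexx (minlen z)).
  rewrite [RHS](the_path_unique (composition_comp cz ct))//.
  congr (the_path _ _ _).
  by rewrite /t subrK.
have := (sameA _ _ (the_path z z t)).1 _
  (qproj N' (pt z) (the_path x z (minlen z))).
rewrite -mmor_nat; apply=> v; have [u <-] := qproj_surj v; rewrite -mmor_nat.
change (ker N (pt z) (@compm K C (pt x) (pt z) (pt z) (the_path z z t) u)).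
apply/(mem_submodule Ix) => l nz; have zl := lcoef_in_range Ix nz;
  apply/(H _ zl).
move: nz; rewrite (lcoef_comp Ix _ _ ct) zl => /(lcoef_in_range Ix).
by rewrite in_rangeE /t => /andP[? _]; lra.
Qed.

End Decorous.

(** * The two bijections *)

Theorem proposition4p5 (K : closedFieldType) (R : realType) (a b x : R)
    (hx : open_itv a b x) :
  bij_up_to
    (fun M M' : submodule (P_ K a b x) =>
       isomodule (sub_module M) (sub_module M'))
    (fun M => decorous_sub M)
    (fun d : closure_itv a b -> R => admissible x d)
    (fun M => del_up M)
  /\
  bij_up_to
    (fun N N' : quotient_module (P_ K a b x) => isomodule N N')
    (fun N => decorous_quot N)
    (fun d : closure_itv a b -> R => admissible x d)
    (fun N => del_down N).
Proof.
split; split.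
- by move=> M /(decorous_sub_cut hx); exact: cut_admissible.
- move=> M M' /(decorous_sub_cut hx) cM /(decorous_sub_cut hx) cM'.
  split=> [iso|e].
    have A := iso_same_annihilators iso; apply/funext => y; apply/eqP.
    rewrite eq_le (sub_iso_le hx y cM cM' A).
    by rewrite (sub_iso_le hx y cM' cM (fun _ _ _ => iff_sym (A _ _ _))).
  rewrite e in cM; rewrite (cut_inj hx cM cM'); exact: isomodule_refl.
- move=> d /(admissible_cut K hx) [M /(cut_decorous_sub hx) H]; by exists M.
- by move=> N /(decorous_quot_cut hx); exact: cut_admissible.
- move=> N N' /(decorous_quot_cut hx) cN /(decorous_quot_cut hx) cN'.
  split=> [iso|e].
    have A := iso_same_annihilators iso; apply/funext => y; apply/eqP.
    rewrite eq_le (quot_iso_le hx y cN cN' A).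
    by rewrite (quot_iso_le hx y cN' cN (fun _ _ _ => iff_sym (A _ _ _))).
  by rewrite e in cN; apply: ker_iso; exact: cut_inj cN cN'.
- move=> d /(admissible_cut K hx) [M cM]; exists (quotient_of M).
  apply: (cut_decorous_quot hx).
  suff -> : ker (quotient_of M) = M by [].
  by apply: submodule_ext => y u; exact: quotient_of_ker.
Qed.
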